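(* Assume that $\mathbb{E}[|X|^6]<\infty$ for $\mu\in\Theta$ (the distribution of $X$ need not be determined by $\mu$). Let $V_n=\frac1n\sum_{i=1}^n(X_i-Y_n)^2$ for $n\in\mathbb{N}$. Let $\{\delta_n\}_{n\in\mathbb{N}}\subset(0,1)$ with $\Phi\big(\sqrt{\ln\frac1{\delta_n}}\big)\to1-\frac\delta2$ as $n\to\infty$, and let $\rho\in(0,1]$. Let $\mathbf{n}$ (depending on $\varepsilon$) be the smallest $n\in\mathbb{N}$ such that $$V_n+\frac\rho n\le\frac{n}{\ln\frac1{\delta_n}}\times\min\big\{|\mathscr{U}(Y_n,\varepsilon)-Y_n|^2,\ |\mathscr{L}(Y_n,\varepsilon)-Y_n|^2\big\}.$$ Let $\widehat{\boldsymbol\mu}=Y_{\mathbf{n}}$ and $\boldsymbol{\mathcal{I}}=(\mathcal{L}(\widehat{\boldsymbol\mu},\varepsilon),\mathcal{U}(\widehat{\boldsymbol\mu},\varepsilon))$. Then for every $\mu\in\Theta$: (I) $\Pr\{\mathbf{n}<\infty\}=1$ and $\mathbb{E}[\mathbf{n}]<\infty$. (II) $\Pr\{\lim_{\varepsilon\downarrow0}\mathbf{n}/\mathcal{N}(\varepsilon,\delta,\mu,\nu)=1\}=1$. (III) $\lim_{\varepsilon\downarrow0}\Pr\{\mu\in\boldsymbol{\mathcal{I}}\}=1-\delta$. (IV) $\lim_{\varepsilon\downarrow0}\mathbb{E}[\mathbf{n}]/\mathcal{N}(\varepsilon,\delta,\mu,\nu)=1$.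
   Context: $X$ is a real random variable with mean $\mu=\mathbb{E}[X]$ and variance $\nu=\mathbb{E}[|X-\mu|^2]>0$; the set of possible values of $\mu$ is an interval $\Theta\subseteq\mathbb{R}$. $X_1,X_2,\dots$ are i.i.d. samples of $X$ and $Y_n=\frac1n\sum_{i=1}^nX_i$. $\Phi$ is the standard normal distribution function, $\delta\in(0,1)$ is fixed, and $\mathcal{Z}=\Phi^{-1}(1-\delta/2)$. $\mathscr{L}(z,\varepsilon)$ and $\mathscr{U}(z,\varepsilon)$, for $z\in\mathbb{R}$, $\varepsilon>0$, are real functions such that: (i) they are continuous functions of $z$ and $\varepsilon>0$; (ii) for every $\varepsilon>0$, $\mathscr{L}(z,\varepsilon)\le z\le\mathscr{U}(z,\varepsilon)$ for all $z\in\mathbb{R}$ and $\mathscr{L}(\mu,\varepsilon)<\mu<\mathscr{U}(\mu,\varepsilon)$ for all $\mu\in\Theta$; (iii) for every $\mu\in\Theta$, as $(z,\varepsilon)\to(\mu,0)$ with $\varepsilon\downarrow0$, $\frac{z-\mathscr{L}(z,\varepsilon)}{\varepsilon}$ and $\frac{\mathscr{U}(z,\varepsilon)-z}{\varepsilon}$ both converge to $\kappa(\mu)>0$, where $\kappa$ is a continuous function of $\mu$. The functions $\mathcal{L}(z,\varepsilon)$, $\mathcal{U}(z,\varepsilon)$ are in the same class in the sense that for every $\mu\in\Theta$, as $z\to\mu$, $\varepsilon\downarrow0$ jointly, $\frac{z-\mathcal{L}(z,\varepsilon)}{\varepsilon}$ and $\frac{\mathcal{U}(z,\varepsilon)-z}{\varepsilon}$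 also both converge to $\kappa(\mu)$. $\mathcal{N}(\varepsilon,\delta,\mu,\nu)=\dfrac{\nu\mathcal{Z}^2}{[\kappa(\mu)\varepsilon]^2}$. For all $\varepsilon>0$ the sample sizes $\mathbf{n}$ are defined from the same sequence $X_1,X_2,\dots$.
   Formalization: Added assumption: for every z outside Θ, min{|𝒰(z,ε)−z|²,|ℒ(z,ε)−z|²}→0 as ε↓0 (script margins); without it the rule can stop at n=1 for all ε. Also the functions in the interval I are assumed Borel in z. *)

(* Defs.v *)
From HB Require Import structures.
From mathcomp Require Import all_boot all_order all_algebra.
From mathcomp Require Import all_classical all_reals all_analysis.

Set Implicit Arguments.
Unset Strict Implicit.
Unset Printing Implicit Defensive.

Import Order.TTheory GRing.Theory Num.Theory.
Import numFieldNormedType.Exports.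

Local Open Scope classical_set_scope.
Local Open Scope ring_scope.

Section StandardNormal.
Context {R : realType}.

Definition stdnormal_cdf (x : R) : R := fine (normal_prob 0 1 `]-oo, x]).

(* The CDF is injective with range ]0, 1[; the default value 0 of the partial
   inverse is only used outside ]0, 1[. *)
Definition stdnormal_quantile (p : R) : R :=
  'pinv_(fun=> 0) [set: R] stdnormal_cdf p.

End StandardNormal.

Section IID.
Context d (T : measurableType d) (R : realType) (P : probability T R).

Definition mutually_independent (X : nat -> {RV P >-> R}) : Prop :=
  forall (s : seq nat) (A : nat -> set R), uniq s ->
    (forall i, measurable (A i)) ->
    P (\bigcap_(i in [set` s]) (X i @^-1` A i)) =
    (\prod_(i <- s) P (X i @^-1` A i))%E.

Definition iid_samples (X : {RV P >-> R}) (Xs : nat -> {RV P >-> R}) : Prop :=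
  mutually_independent Xs /\
  forall i (A : set R), measurable A ->
    distribution P (Xs i) A = distribution P X A.

End IID.

Section Sampling.
Context {T : Type} {R : realType}.

(* The sample X_(i+1) of the mathematical text is [Xs i]; both statistics are
   meant for n >= 1. *)
Definition sample_mean (Xs : nat -> T -> R) (n : nat) (w : T) : R :=
  n%:R^-1 * \sum_(i < n) Xs i w.

Definition sample_var (Xs : nat -> T -> R) (n : nat) (w : T) : R :=
  n%:R^-1 * \sum_(i < n) (Xs i w - sample_mean Xs n w) ^+ 2.

Definition stop_cond (L U : R -> R -> R) (delta_ : nat -> R) (rho : R)
    (Xs : nat -> T -> R) (eps : R) (n : nat) (w : T) : Prop :=
  let y := sample_mean Xs n w in
  sample_var Xs n w + rho / n%:R <=
  n%:R / ln (delta_ n)^-1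
  * Num.min (`|U y eps - y| ^+ 2) (`|L y eps - y| ^+ 2).

(* The smallest n >= 1 satisfying the stopping condition, +oo if none does. *)
Definition sample_size (L U : R -> R -> R) (delta_ : nat -> R) (rho : R)
    (Xs : nat -> T -> R) (eps : R) (w : T) : \bar R :=
  ereal_inf [set (n%:R)%:E | n in
    [set n | (0 < n)%N /\ stop_cond L U delta_ rho Xs eps n w]].

(* The event that sampling stops, at some n = k, and that the open interval
   ]calL(Y_k, eps), calU(Y_k, eps)[ contains mu. *)
Definition coverage_event (L U calL calU : R -> R -> R) (delta_ : nat -> R)
    (rho : R) (Xs : nat -> T -> R) (mu eps : R) : set T :=
  [set w | exists k : nat,
    sample_size L U delta_ rho Xs eps w = (k%:R)%:E /\
    calL (sample_mean Xs k w) eps < mu < calU (sample_mean Xs k w) eps].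

End Sampling.

Section Limits.
Context {R : realType}.

Definition margins_equiv (Theta : set R) (kappa : R -> R) (L U : R -> R -> R)
    : Prop :=
  forall mu, Theta mu ->
    ((x.1 - L x.1 x.2) / x.2 @[x --> (nbhs mu, 0^'+)] --> kappa mu) /\
    ((U x.1 x.2 - x.1) / x.2 @[x --> (nbhs mu, 0^'+)] --> kappa mu).

(* On Theta this is a consequence of [margins_equiv].  Off Theta, where sample
   means may fall, it is what excludes stopping at a bounded sample size for
   arbitrarily small eps. *)
Definition margins_vanish_off (Theta : set R) (L U : R -> R -> R) : Prop :=
  forall z, ~ Theta z ->
    Num.min (`|U z eps - z| ^+ 2) (`|L z eps - z| ^+ 2)
      @[eps --> 0^'+] --> (0 : R).

Definition asymp_size (kappa : R -> R) (eps delta mu nu : R) : R :=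
  nu * stdnormal_quantile (1 - delta / 2) ^+ 2 / (kappa mu * eps) ^+ 2.

End Limits.

(* Main.v *)
(* Let M(e) be the asymptotic size.  Almost surely the sample mean and variance
   converge, so both sides of the stopping condition become deterministic up to
   factors 1 +- eta; this squeezes the sample size between (1 - eta) M(e) and
   (1 + eta) M(e), which is (II).  The expected sample size is the sum over n of
   P(sample size > n), and for n beyond (1 + eta) M(e) that event forces either
   the sample mean away from mu (probability O(1/n^2), by fourth moments) or the
   mean of the squared deviations to be of order n/M(e) (Chebyshev); this gives
   (I) and (IV).  For (III), Kolmogorov's maximal inequality on the block of
   times [(1 - eta) M(e), (1 + eta) M(e)] replaces the random sample size by a
   deterministic one (Anscombe), and the central limit theorem applies.  The
   latter is proved by telescoping: u(s, y) = Phi(y / sqrt s) solves the heat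
   equation u_s = u_yy / 2, so E u(s, b - S_k) hardly changes when one increment
   of the walk S is traded for one unit of s, and the remaining smoothing by Phi
   is removed by monotonicity. *)

Require Import Defs.
From HB Require Import structures.
From mathcomp Require Import all_boot all_order all_algebra.
From mathcomp Require Import all_classical all_reals all_analysis.
From mathcomp Require Import measurable_realfun.
From mathcomp Require Import ring lra.

Set Implicit Arguments.
Unset Strict Implicit.
Unset Printing Implicit Defensive.

Import Order.TTheory GRing.Theory Num.Theory.
Import numFieldNormedType.Exports.

Local Open Scope classical_set_scope.
Local Open Scope ring_scope.

(** * Real-valued expectations and probabilities *)

(** The almost sure limits say nothing about small n. That sampling does not stop early rests on rho
    / n, which is positive at each fixed n while the margin there tends to 0 with e, whether or not
    the sample mean lies in Theta. The window for the sample size is a deterministic statement about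
    one path; it holds for all small e at once, with a threshold that depends on the path. Passing
    to sequences of e turns it into a statement on probabilities without forming unions over a
    continuum of e. In the tail sums, the deviation of the mean needs fourth moments because the 1 /
    n of Chebyshev is not summable; for the squared deviations the admissible excess grows linearly
    with n, so the level for their sum grows like n^2 and second moments suffice. The tails beyond a
    multiple of M(e) then add up to a quantity bounded in e, negligible against M(e). In the central
    limit theorem a smoothing of variance a^4 n costs O(1 / (a^6 sqrt n)) in all, and a shift by a
    sqrt n is 1 / a smoothing widths; so n tends to infinity for fixed small a. *)

Section Expectation.
Context d (T : measurableType d) (R : realType) (P : probability T R).
Implicit Types (f g : T -> R) (A B C : set T).

Definition L1 f := P.-integrable [set: T] (EFin \o f).
(** The value is 0 by default when the integral is infinite; the [L1] hypotheses below exclude that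
    case. *)
Definition mean f : R := \int[P]_w f w.
Definition pr (A : set T) : R := fine (P A).

Lemma L1_measurable f : L1 f -> measurable_fun [set: T] f.
Proof. by move=> /measurable_int/measurable_EFinP. Qed.

Lemma L1D f g : L1 f -> L1 g -> L1 (fun w => f w + g w).
Proof. by move=> Lf Lg; exact: (integrableD measurableT Lf Lg). Qed.

Lemma L1B f g : L1 f -> L1 g -> L1 (fun w => f w - g w).
Proof. by move=> Lf Lg; exact: (integrableB measurableT Lf Lg). Qed.

Lemma L1Z a f : L1 f -> L1 (fun w => a * f w).
Proof. by move=> Lf; exact: (integrableZl measurableT a Lf). Qed.

Lemma L1_cst a : L1 (fun=> a).
Proof. exact: finite_measure_integrable_cst. Qed.

Lemma L1_le f g : measurable_fun [set: T] f -> (forall w, `|f w| <= g w) ->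
  L1 g -> L1 f.
Proof.
move=> mf fg; apply: le_integrable => //; first exact/measurable_EFinP.
by move=> w _ /=; rewrite lee_fin (le_trans (fg w))// ler_norm.
Qed.

Lemma L1_norm f : L1 f -> L1 (fun w => `|f w|).
Proof. exact: integrable_norm. Qed.

Lemma EFin_mean f : L1 f -> (\int[P]_w (f w)%:E)%E = (mean f)%:E.
Proof. by move=> Lf; rewrite /mean /Rintegral fineK//; exact: integrable_fin_num. Qed.

Lemma meanD f g : L1 f -> L1 g -> mean (fun w => f w + g w) = mean f + mean g.
Proof. exact: RintegralD. Qed.

Lemma meanB f g : L1 f -> L1 g -> mean (fun w => f w - g w) = mean f - mean g.
Proof. exact: RintegralB. Qed.

Lemma meanZ a f : L1 f -> mean (fun w => a * f w) = a * mean f.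
Proof. exact: RintegralZl. Qed.

Lemma mean_cst a : mean (fun=> a) = a.
Proof.
by rewrite /mean Rintegral_cst//= (@probability_setT _ _ _ P) mulr1. Qed.

Lemma mean_ge0 f : (forall w, 0 <= f w) -> 0 <= mean f.
Proof. by move=> f0; apply: Rintegral_ge0. Qed.

Lemma le_mean f g : L1 f -> L1 g -> (forall w, f w <= g w) -> mean f <= mean g.
Proof. by move=> Lf Lg fg; apply: le_Rintegral. Qed.

Lemma le_norm_mean f : L1 f -> `|mean f| <= mean (fun w => `|f w|).
Proof. exact: le_normr_Rintegral. Qed.

Lemma mean_indic (A : set T) : measurable A -> mean \1_A = pr A.
Proof. by move=> mA; rewrite /mean /Rintegral integral_indic// setIT. Qed.

Lemma L1_indic (A : set T) : measurable A -> L1 \1_A.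
Proof.
by move=> mA; apply: integrable_indic => //; rewrite fin_num_fun_lty.
Qed.

Lemma markov_mean f a : L1 f -> (forall w, 0 <= f w) -> 0 < a ->
  pr [set w | a <= f w] <= a^-1 * mean f.
Proof.
move=> Lf f0 a0; have mf := L1_measurable Lf.
have mA : measurable [set w | a <= f w].
  rewrite -[X in measurable X]setTI.
  exact: measurable_fun_le.
rewrite -(mean_indic mA) -meanZ//; apply: le_mean; [exact: L1_indic|exact: L1Z|].
move=> w; rewrite indicE; case: (boolP (w \in _)) => [|_]/=.
  by rewrite inE /= => aw; rewrite mulrC ler_pdivlMr// mul1r.
by rewrite mulr_ge0// invr_ge0 ltW.
Qed.

Lemma EFin_pr A : measurable A -> (pr A)%:E = P A.
Proof. by move=> mA; rewrite /pr fineK// fin_num_measure. Qed.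

Lemma pr_ge0 A : 0 <= pr A.
Proof. exact: fine_ge0. Qed.

Lemma pr_le1 A : measurable A -> pr A <= 1.
Proof. by move=> mA; rewrite -lee_fin EFin_pr// probability_le1. Qed.

Lemma le_pr A B : measurable A -> measurable B -> A `<=` B -> pr A <= pr B.
Proof. by move=> mA mB AB; rewrite -lee_fin !EFin_pr// le_measure// inE. Qed.

Lemma prU_le A B : measurable A -> measurable B -> pr (A `|` B) <= pr A + pr B.
Proof.
move=> mA mB; rewrite -lee_fin EFinD !EFin_pr//; last exact: measurableU.
exact: measureU2.
Qed.

Lemma le_prU A B C : measurable A -> measurable B -> measurable C ->
  A `<=` B `|` C -> pr A <= pr B + pr C.
Proof.
move=> mA mB mC ABC; apply: le_trans (prU_le mB mC).
by apply: le_pr => //; exact: measurableU.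
Qed.

Lemma prC A : measurable A -> pr (~` A) = 1 - pr A.
Proof.
move=> mA; apply: EFin_inj; rewrite EFin_pr ?EFinB ?EFin_pr//.
  exact: probability_setC.
exact: measurableC.
Qed.

Lemma prD_le A B C : measurable A -> measurable B -> measurable C ->
  [disjoint A & B] -> A `|` B `<=` C -> pr A + pr B <= pr C.
Proof.
move=> mA mB mC AB ABC; have mAB := measurableU _ _ mA mB.
rewrite -lee_fin EFinD !EFin_pr// -measureU//; last exact/disj_set2P.
by apply: le_measure => //; rewrite inE.
Qed.

End Expectation.

(** * Independence of the past *)

Section Past.
Context d (T : measurableType d) (R : realType) (P : probability T R).
Variable Xs : nat -> {RV P >-> R}.

(** Rectangles in the first [n] samples. They are stable under intersection, so equalities of finite
    measures checked on them extend to the sigma-algebra of the past. *)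
Definition cylinders n : set (set T) :=
  [set D | exists2 A : nat -> set R, (forall i, measurable (A i)) &
           D = \bigcap_(i in [set` iota 0 n]) (Xs i @^-1` A i)].

Definition adapted n (f : T -> R) :=
  measurable_fun ([set: g_sigma_algebraType (cylinders n)]) f.

Lemma cylinders_measurable n : cylinders n `<=` measurable.
Proof.
move=> _ [A mA ->]; apply: fin_bigcap_measurable => // i _.
exact: measurable_funPTI.
Qed.

Lemma past_measurable n : <<s cylinders n >> `<=` measurable.
Proof. exact: smallest_sub (@sigma_algebra_measurable _ T) (@cylinders_measurable n). Qed.

Lemma adapted_measurable n f : adapted n f -> measurable_fun [set: T] f.
Proof. by move=> mf _ B mB; apply: (@past_measurable n); exact: mf. Qed.

Lemma cylinders_setI n : setI_closed (cylinders n).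
Proof.
move=> _ _ [A mA ->] [B mB ->]; exists (fun i => A i `&` B i) => [i|].
  exact: measurableI.
by rewrite -bigcapI.
Qed.

Lemma cylinders_setT n : cylinders n [set: T].
Proof.
exists (fun=> setT) => //; apply/esym; rewrite -subTset => w _ i _ //=.
Qed.

Lemma cylinders_mono m n : (m <= n)%N -> cylinders m `<=` cylinders n.
Proof.
move=> mn _ [A mA ->]; exists (fun i => if (i < m)%N then A i else setT).
  by move=> i; case: ifP.
apply/seteqP; split=> w /= Aw i /=; rewrite mem_iota add0n/= => lti.
  by case: ifP => // im; apply: Aw; rewrite /= mem_iota.
by have := Aw i; rewrite /= mem_iota add0n/= (leq_trans lti mn) lti; apply.
Qed.

Lemma adapted_mono m n f : (m <= n)%N -> adapted m f -> adapted n f.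
Proof.
move=> mn af _ B mB; have := af measurableT B mB.
by apply: sub_smallest2r => //; exact: cylinders_mono.
Qed.

Lemma adapted_X n i : (i < n)%N -> adapted n (Xs i).
Proof.
move=> ltin _ B mB; rewrite setTI; apply: sub_sigma_algebra.
exists (fun j => if j == i then B else setT) => [j|]; first by case: ifP.
apply/seteqP; split=> w /= Bw => [j _|]; first by case: ifP => [/eqP->|].
by have := Bw i; rewrite /= eqxx mem_iota add0n; apply.
Qed.

Hypothesis indep : mutually_independent Xs.

(** As functions of [D], both sides are finite measures: a restriction of [P] and a multiple of [P].
    On cylinders the claim is mutual independence, and cylinders determine finite measures on the
    sigma-algebra that they generate. *)
Lemma past_indep n m (D : set T) (B : set R) : (n <= m)%N ->
  <<s cylinders n >> D -> measurable B ->
  P (D `&` Xs m @^-1` B) = (P D * P (Xs m @^-1` B))%E.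
Proof.
move=> nm sD mB; have mXB : measurable (Xs m @^-1` B) by exact: measurable_funPTI.
have PB : P (Xs m @^-1` B) \is a fin_num by exact: fin_num_measure.
pose r := NngNum (fine_ge0 (measure_ge0 P (Xs m @^-1` B))).
suff: mrestr P mXB D = mscale r P D.
  by rewrite /mrestr /mscale /= fineK// muleC.
apply: (g_sigma_algebra_measure_unique (cylinders n) _ (fun=> setT)) => //.
- exact: cylinders_measurable.
- by move=> _; exact: cylinders_setT.
- by rewrite bigcup_const//.
- exact: cylinders_setI.
- move=> _ [A mA ->].
  (* Putting [B] at coordinate [m] turns the intersection into a single rectangle over
     [m :: iota 0 n]; [n <= m] keeps this list free of repetitions. *)
  pose A' i := if i == m then B else A i.
  have mA' i : measurable (A' i) by rewrite /A'; case: ifP.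
  have nmem : m \notin iota 0 n by rewrite mem_iota add0n -leqNgt.
  have eqA i : i \in iota 0 n -> A' i = A i.
    by rewrite /A'; case: eqP => // -> /(negP nmem).
  have h1 := indep (s := iota 0 n) (iota_uniq 0 n) mA.
  have := indep (s := m :: iota 0 n) _ mA'; rewrite /= nmem iota_uniq => /(_ isT).
  rewrite big_cons.
  have -> : (\prod_(i <- iota 0 n) P (Xs i @^-1` A' i) =
             \prod_(i <- iota 0 n) P (Xs i @^-1` A i))%E.
    by apply: eq_big_seq => i /eqA ->.
  rewrite -h1 {2}/A' eqxx /mscale /mrestr/= fineK// => <-.
  congr (P _); apply/seteqP; split=> w /=.
    move=> [Aw Bw] i /=; rewrite inE => /orP[/eqP->|ii]; first by rewrite /A' eqxx.
    by rewrite eqA//; exact: Aw.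
  move=> Aw; split=> [i /= ii|].
    by have := Aw i; rewrite /= inE ii orbT eqA//; apply.
  by have := Aw m; rewrite /= inE eqxx /A' eqxx; apply.
- by move=> _; rewrite /mrestr /= (le_lt_trans (probability_le1 _ _)) ?ltry//; exact: measurableI.
Qed.

(** By independence the joint law of [f] and [Xs m] is the product of their laws; Tonelli gives
    integrability and Fubini the factorization. All later uses of independence go through this
    lemma. *)
Lemma adapted_prod n m f (g : R -> R) : (n <= m)%N ->
  adapted n f -> measurable_fun [set: R] g -> L1 P f -> L1 P (g \o Xs m) ->
  L1 P (fun w => f w * g (Xs m w)) /\
  mean P (fun w => f w * g (Xs m w)) = mean P f * mean P (g \o Xs m).
Proof.
move=> nm af mg Lf Lg.
have mf := adapted_measurable af.
pose F : {RV P >-> R} := HB.pack f (isMeasurableFun.Build _ _ _ _ f mf).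
pose XY : T -> R * R := fun w => (f w, Xs m w).
have mXY : measurable_fun setT XY by exact: measurable_fun_pair.
pose Z : {mfun T >-> (R * R)%type} := HB.pack XY (isMeasurableFun.Build _ _ _ _ XY mXY).
have ZE C : measurable C ->
    (distribution P F \x distribution P (Xs m))%E C = distribution P Z C.
  apply: product_measure_unique => A B mA mB.
  rewrite /distribution /pushforward/=.
  rewrite -(past_indep nm) //; last by have := af measurableT A mA; rewrite setTI.
pose h : R * R -> \bar R := fun z => (z.1 * g z.2)%:E.
have mh : measurable_fun setT h.
  by apply/measurable_EFinP/measurable_funM => //; exact: measurableT_comp.
have mgE : measurable_fun setT (EFin \o g) by exact/measurable_EFinP.
have ih : (distribution P F \x distribution P (Xs m))%E.-integrable setT h.
  apply/integrable12ltyP => //.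
  have -> : (\int[distribution P F]_x \int[distribution P (Xs m)]_y `|h (x, y)| =
     \int[distribution P F]_x (`|x|%:E * \int[distribution P (Xs m)]_y `|g y|%:E))%E.
    apply: eq_integral => x _; rewrite -ge0_integralZl//.
    + by apply: eq_integral => y _; rewrite /h /= normrM EFinM.
    + by apply/measurable_EFinP; exact: measurableT_comp.
  have cfin : (\int[distribution P (Xs m)]_y `|g y|%:E < +oo)%E.
    rewrite ge0_integral_distribution//; last first.
      by apply/measurable_EFinP; exact: measurableT_comp.
    by move/integrableP: Lg => -[].
  have mabs : measurable_fun [set: R] (fun x : R => `|x|%:E).
    by apply/measurable_EFinP; exact: (@normr_measurable R [set: R]).
  have dfin : (\int[distribution P F]_x `|x|%:E < +oo)%E.
    by rewrite ge0_integral_distribution//; move/integrableP: Lf => -[].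
  rewrite ge0_integralZr//; last exact: integral_ge0.
  by apply: lte_mul_pinfty; rewrite ?integral_ge0// ge0_fin_numE// integral_ge0.
have ihZ : (distribution P Z).-integrable setT h.
  apply/integrableP; split => //.
  rewrite (eq_measure_integral (distribution P F \x distribution P (Xs m))%E).
    by move/integrableP: ih => -[].
  by move=> C mC _; first [by rewrite ZE | by have := ZE C mC; apply: esym].
have Lfg : L1 P (fun w => f w * g (Xs m w)).
  apply/integrableP; split.
    apply/measurable_EFinP/measurable_funM => //.
    exact: measurableT_comp.
  move/integrableP : ihZ => -[_].
  by rewrite ge0_integral_distribution//; exact: measurableT_comp.
split=> //; apply: EFin_inj; rewrite -EFin_mean// EFinM -!EFin_mean//.
transitivity (\int[distribution P Z]_z h z)%E; first by rewrite integral_distribution.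
rewrite (eq_measure_integral (distribution P F \x distribution P (Xs m))%E); last first.
  by move=> C mC _; first [by rewrite ZE | by have := ZE C mC; apply: esym].
rewrite -integral12_prod_meas1//.
have igX : (distribution P (Xs m)).-integrable setT (EFin \o g).
  by apply: integrable_pushforward.
have iF : (distribution P F).-integrable setT (fun x => x%:E).
  apply: integrable_pushforward => //. exact: EFin_measurable.
rewrite /fubini_F.
transitivity (\int[distribution P F]_x (x%:E * \int[distribution P (Xs m)]_y (g y)%:E))%E.
  apply: eq_integral => x _; rewrite -integralZl//.
have gE : (\int[distribution P (Xs m)]_y (g y)%:E = \int[P]_w (g (Xs m w))%:E)%E.
  by rewrite integral_distribution.
rewrite gE EFin_mean// integralZr// -EFin_mean//.
by rewrite integral_distribution.
Qed.

End Past.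

(** * Maximal inequality, law of large numbers, fourth moments *)

Section RandomWalk.
Context d (T : measurableType d) (R : realType) (P : probability T R).
Variables (X : {RV P >-> R}) (Xs : nat -> {RV P >-> R}).
Hypothesis X_iid : iid_samples X Xs.
Variable g : R -> R.
Hypothesis mg : measurable_fun [set: R] g.

Definition psum m n w : R := \sum_(m <= i < n) g (Xs i w).

Lemma psum_cat m n w : (m <= n)%N -> psum m n w = psum 0 n w - psum 0 m w.
Proof.
by move=> mn; rewrite /psum (big_cat_nat (n := m) (leq0n m) mn)/= addrAC subrr add0r.
Qed.

Lemma iid_L1 (h : R -> R) i : measurable_fun [set: R] h ->
  L1 P (h \o X) -> L1 P (h \o Xs i).
Proof.
move=> mh Lh; have mhE : measurable_fun setT (EFin \o h) by exact/measurable_EFinP.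
have /integrableP[_ hoo] : (distribution P X).-integrable setT (EFin \o h).
  exact: integrable_pushforward.
apply/integrableP; split.
  by apply/measurable_EFinP; exact: measurableT_comp.
move: hoo; rewrite (eq_measure_integral (distribution P (Xs i))).
  by rewrite ge0_integral_distribution//; exact: measurableT_comp.
by move=> A mA _; apply/esym; exact: X_iid.2.
Qed.

Lemma iid_mean (h : R -> R) i : measurable_fun [set: R] h ->
  L1 P (h \o X) -> mean P (h \o Xs i) = mean P (h \o X).
Proof.
move=> mh Lh; have mhE : measurable_fun setT (EFin \o h) by exact/measurable_EFinP.
apply: EFin_inj; rewrite -!EFin_mean//; last exact: iid_L1.
have h1 := integral_distribution mhE Lh.
have h2 := integral_distribution mhE (iid_L1 i mh Lh).
rewrite -[LHS]h2 -[RHS]h1; apply: eq_measure_integral => A mA _.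
exact: X_iid.2.
Qed.

Lemma adapted_psum m n : adapted Xs n (psum m n).
Proof.
elim: n => [|n IH].
  rewrite /psum; under eq_fun do rewrite big_geq//; exact: measurable_cst.
have [mn|mn] := leqP m n; last first.
  rewrite /psum; under eq_fun do rewrite big_geq//; exact: measurable_cst.
rewrite /psum; under eq_fun do rewrite big_nat_recr//=.
apply: measurable_funD; first exact: adapted_mono IH.
by apply: measurableT_comp => //; apply: adapted_X.
Qed.

Lemma measurable_psum m n : measurable_fun [set: T] (psum m n).
Proof. exact: (adapted_measurable (@adapted_psum m n)). Qed.

(** The walk started at time [m] and frozen on leaving ]-a, a[. The indicator that releases the next
    increment depends on the past alone, so released increments stay uncorrelated with the current
    value. *)
Fixpoint stopped a m k w : R :=
  if k is k'.+1 then
    let t := stopped a m k' w in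
    t + (if `|t| < a then 1 else 0) * g (Xs (m + k') w)
  else 0.

(** Once frozen outside ]-a, a[, the walk never comes back: being inside at step [k] means that it
    has not been frozen. *)
Lemma stoppedP a m k w : `|stopped a m k w| < a ->
  forall j, (j <= k)%N -> stopped a m j w = psum m (m + j) w /\ `|psum m (m + j) w| < a.
Proof.
elim: k => [/= a0 j|k IH /=].
  rewrite leqn0 => /eqP ->; rewrite addn0 /psum big_geq//=.
case: ifP => [ta|ta]; last by rewrite mul0r addr0 ta.
rewrite mul1r => ta1 j; rewrite leq_eqVlt => /predU1P[->|]; last exact: IH.
have eqk : stopped a m k.+1 w = psum m (m + k.+1) w.
  have [jk _] := IH ta k (leqnn k).
  rewrite /= ta mul1r jk /psum addnS big_nat_recr ?leq_addr//=.
split => //; rewrite -eqk /= ta mul1r//.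
Qed.

Hypotheses (Lg : L1 P (g \o X)) (Lg2 : L1 P (fun w => g (X w) ^+ 2)).
Hypothesis g_mean0 : mean P (g \o X) = 0.

Let s2 := mean P (fun w => g (X w) ^+ 2).

Let mg2 : measurable_fun [set: R] (fun x => g x ^+ 2).
Proof. exact: measurable_funX. Qed.


Lemma adapted_stopped a m k : adapted Xs (m + k) (stopped a m k).
Proof.
elim: k => [|k IH]; first exact: measurable_cst.
rewrite addnS; have IH' := adapted_mono (leqnSn _) IH.
apply: measurable_funD => //; apply: measurable_funM; last first.
  by apply: measurableT_comp => //; apply: adapted_X.
apply: measurable_fun_ifT => //; apply: measurable_fun_ltr => //.
exact: measurableT_comp.
Qed.

(** The cross term has mean zero, since the new increment is centred and independent of the past; a
    released increment adds at most [s2]. *)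
Lemma stopped_sqr a m k : 0 < a -> L1 P (fun w => stopped a m k w ^+ 2) /\
  mean P (fun w => stopped a m k w ^+ 2) <= k%:R * s2.
Proof.
move=> a0; elim: k => [|k [LT IH]] /=.
  rewrite expr0n/= mul0r mean_cst; split => //; exact: L1_cst.
pose ind w : R := if `|stopped a m k w| < a then 1 else 0.
have aind : adapted Xs (m + k) ind.
  apply: measurable_fun_ifT => //; apply: measurable_fun_ltr => //.
  by apply: measurableT_comp => //; exact: adapted_stopped.
have aTi : adapted Xs (m + k) (fun w => stopped a m k w * ind w).
  by apply: measurable_funM => //; exact: adapted_stopped.
(* Wherever an increment is released the stopped value is below [a]; boundedness makes the cross
   term integrable. *)
have LTi : L1 P (fun w => stopped a m k w * ind w).
  apply: (L1_le (g := fun=> a)); [exact: adapted_measurable aTi| |exact: L1_cst].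
  move=> w; rewrite /ind; case: ifP => [/ltW|_]; rewrite ?mulr1// mulr0 normr0 ltW//.
have [L1x mx] := adapted_prod X_iid.1 (leqnn _) aTi mg LTi (iid_L1 (m + k) mg Lg).
have Lgk := iid_L1 (m + k) mg2 Lg2.
have Lig : L1 P (fun w => ind w * g (Xs (m + k) w) ^+ 2).
  apply: (L1_le _ _ Lgk); last first.
    move=> w /=; rewrite /ind; case: ifP => _; first by rewrite mul1r ger0_norm// sqr_ge0.
    by rewrite mul0r normr0 sqr_ge0.
  apply: measurable_funM; first exact: adapted_measurable aind.
  exact: L1_measurable Lgk.
have -> : (fun w => (stopped a m k w + ind w * g (Xs (m + k) w)) ^+ 2) =
    (fun w => (stopped a m k w ^+ 2 + 2 * (stopped a m k w * ind w * g (Xs (m + k) w)))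
      + ind w * g (Xs (m + k) w) ^+ 2).
  by apply/funext => w; rewrite /ind; case: ifP => _; ring.
have LL := L1D LT (L1Z 2 L1x); split; first exact: L1D.
rewrite meanD// meanD//; last exact: L1Z.
rewrite meanZ// mx iid_mean// g_mean0 !mulr0 addr0 -natr1 mulrDl mul1r.
apply: lerD => //; rewrite -[s2](iid_mean (m + k) mg2 Lg2).
apply: le_mean => // w /=; rewrite /ind; case: ifP => _; first by rewrite mul1r.
by rewrite mul0r sqr_ge0.
Qed.

Definition max_exceeds a m k :=
  [set w | exists2 j, (j <= k)%N & a <= `|psum m (m + j) w|].

Lemma measurable_exceeds a m n : measurable [set w | a <= `|psum m n w|].
Proof.
rewrite -[X in measurable X]setTI; apply: measurable_fun_le => //.
by apply: measurableT_comp => //; exact: measurable_psum.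
Qed.

Lemma measurable_max_exceeds a m k : measurable (max_exceeds a m k).
Proof.
have -> : max_exceeds a m k =
    \bigcup_(j in [set j | (j <= k)%N]) [set w | a <= `|psum m (m + j) w|].
  by apply/seteqP; split=> w [j jk aj]; exists j.
apply: bigcup_measurable => j _; exact: measurable_exceeds.
Qed.

(* Kolmogorov's maximal inequality: the walk stopped on leaving ]-a, a[ has
   second moment at most k s2, and it ends outside ]-a, a[ on the event. *)
Lemma maximal_inequality a m k : 0 < a ->
  pr P (max_exceeds a m k) <= k%:R * s2 / a ^+ 2.
Proof.
move=> a0; have [LT mT] := stopped_sqr m k a0.
have := markov_mean LT (fun w => sqr_ge0 _) (exprn_gt0 2 a0).
move=> h; apply: (@le_trans _ _ (pr P [set w | a ^+ 2 <= stopped a m k w ^+ 2])).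
  apply: le_pr; first exact: measurable_max_exceeds.
    rewrite -[X in measurable X]setTI; apply: measurable_fun_le => //.
    exact: L1_measurable LT.
  move=> w [j jk aj] /=; rewrite -(real_normK (num_real (stopped _ _ _ _))).
  rewrite ler_sqr ?nnegrE// ?(ltW a0)//.
  rewrite leNgt; apply/negP => /stoppedP/(_ _ jk)[_]; by rewrite ltNge aj.
apply: (le_trans h); rewrite mulrC ler_wpM2r// invr_ge0 sqr_ge0//.
Qed.

Lemma chebyshev_psum a n : 0 < a ->
  pr P [set w | a <= `|psum 0 n w|] <= n%:R * s2 / a ^+ 2.
Proof.
move=> a0; apply: le_trans (maximal_inequality 0 n a0); apply: le_pr.
- exact: measurable_exceeds.
- exact: measurable_max_exceeds.
- by move=> w aw; exists n.
Qed.

End RandomWalk.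

Lemma nneseries_le_bound (R : realType) (u : nat -> \bar R) (C : \bar R) m :
  (forall n, 0 <= u n)%E -> (forall n, \sum_(m <= i < n) u i <= C)%E ->
  (\sum_(m <= i <oo) u i <= C)%E.
Proof.
move=> u0 uC; apply: lime_le; last exact: nearW.
by apply: is_cvg_nneseries => n _ _; exact: u0.
Qed.

Section BorelCantelli.
Context d (T : measurableType d) (R : realType) (P : probability T R).

Lemma borel_cantelli (B : nat -> set T) C : (forall n, measurable (B n)) ->
  (forall n, \sum_(0 <= j < n) pr P (B j) <= C) ->
  {ae P, forall w, exists n, forall j, (n <= j)%N -> ~ B j w}.
Proof.
move=> mB BC; exists (lim_sup_set B); split.
- by apply: bigcap_measurable => // k _; exact: bigcup_measurable.
- apply: lim_sup_set_cvg0 => //; apply: (@le_lt_trans _ _ C%:E); last exact: ltry.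
  apply: nneseries_le_bound => // n.
  by rewrite -(eq_bigr _ (fun j _ => EFin_pr P (mB j))) sumEFin lee_fin.
- move=> w /= Bw n _; apply: contrapT => nB; apply: Bw; exists n => j nj Bj.
  by apply: nB; exists j.
Qed.

(* Continuity from above along the tails of B. *)
Lemma ae_eventually_not_pr0 (B : nat -> set T) : (forall n, measurable (B n)) ->
  {ae P, forall w, \forall n \near \oo, ~ B n w} ->
  pr P (B n) @[n --> \oo] --> (0 : R).
Proof.
move=> mB [N [mN PN subN]].
have mU n : measurable (\bigcup_(k >= n) B k) by exact: bigcup_measurable.
have PL0 : P (lim_sup_set B) = 0%E.
  apply/eqP; rewrite eq_le measure_ge0 andbT -PN; apply: le_measure.
  - by rewrite inE; apply: bigcap_measurable => // k _; exact: mU.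
  - by rewrite inE.
  - move=> w Lw; apply: subN => /= -[n _ nB].
    by have [j /= nj] := Lw n I; exact: nB.
have tails : P (\bigcup_(k >= n) B k) @[n --> \oo] --> 0%E.
  rewrite -PL0; apply: lim_sup_set_cvg => //.
  by rewrite (le_lt_trans (probability_le1 _ _)) ?ltry//; exact: mU.
apply/cvgrPdist_le => e e0.
have /fine_cvgP[_ /cvgrPdist_le/(_ e e0)] := tails.
apply: filterS => n; rewrite !sub0r !normrN /= => h.
rewrite ger0_norm ?pr_ge0//; apply: le_trans h.
rewrite ger0_norm ?fine_ge0//.
by apply: le_pr => // w Bw; exists n => /=.
Qed.

End BorelCantelli.

Lemma sum_half_le (R : realType) n : \sum_(0 <= j < n) (2^-1 : R) ^+ j <= 2.
Proof.
suff -> : \sum_(0 <= j < n) (2^-1 : R) ^+ j = 2 - 2 * 2^-1 ^+ n.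
  by rewrite gerBl mulr_ge0// exprn_ge0// invr_ge0.
elim: n => [|n IH]; first by rewrite big_geq// expr0 mulr1 subrr.
by rewrite big_nat_recr//= IH exprS; lra.
Qed.

Section LawOfLargeNumbers.
Context d (T : measurableType d) (R : realType) (P : probability T R).
Variables (X : {RV P >-> R}) (Xs : nat -> {RV P >-> R}).
Hypothesis X_iid : iid_samples X Xs.
Variable g : R -> R.
Hypothesis mg : measurable_fun [set: R] g.
Hypothesis Lg : L1 P (g \o X).
Hypothesis Lg2 : L1 P (fun w => g (X w) ^+ 2).
Hypothesis g_mean0 : mean P (g \o X) = 0.

(* The maximal inequality on dyadic blocks, then Borel-Cantelli. *)
Lemma strong_law :
  {ae P, forall w, (psum Xs g 0 n w / n%:R) @[n --> \oo] --> (0 : R)}.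
Proof.
pose s2 := mean P (fun w => g (X w) ^+ 2).
have s20 : 0 <= s2 by apply: mean_ge0 => w; exact: sqr_ge0.
(* The levels 1 / (p + 1) stand for an arbitrary positive e, so that a single null set serves them
   all. *)
pose eta (p : nat) : R := p.+1%:R^-1.
have eta0 p : 0 < eta p by rewrite invr_gt0.
(* Event [j] covers all times up to 2^(j+1) at level [eta p] 2^j, and the maximal inequality bounds
   it by a constant times 2^-j. A time n is handled by the event of its binary logarithm. *)
pose B p j := max_exceeds Xs g (eta p * 2 ^+ j) 0 (2 ^ j.+1).
have aeB p : {ae P, forall w, exists n, forall j, (n <= j)%N -> ~ B p j w}.
  apply: (@borel_cantelli _ _ _ _ _ ((2 * s2 / eta p ^+ 2) * 2)).
    by move=> j; exact: measurable_max_exceeds.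
  move=> n; apply: (@le_trans _ _ (\sum_(0 <= j < n) (2 * s2 / eta p ^+ 2) * 2^-1 ^+ j)).
    apply: ler_sum => j _.
    have e0 : 0 < eta p * 2 ^+ j by rewrite mulr_gt0// exprn_gt0.
    apply: (le_trans (maximal_inequality X_iid mg Lg Lg2 g_mean0 0 (2 ^ j.+1) e0)).
    rewrite le_eqVlt; apply/orP; left; apply/eqP.
    rewrite -/s2 natrX exprS exprMn exprVn.
    have h2 : (2 : R) ^+ j != 0 by rewrite expf_neq0.
    have h3 : eta p != 0 by rewrite gt_eqF.
    by field; rewrite h2 h3.
  rewrite -mulr_sumr ler_wpM2l ?sum_half_le//.
  by rewrite !mulr_ge0// invr_ge0 sqr_ge0.
have := ae_foralln aeB; apply: filterS => w Bw.
apply/cvgrPdist_le => e e0.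
have [p pe] : exists p, eta p <= e.
  exists (Num.truncn e^-1); rewrite /eta invf_ple ?posrE//.
  exact/ltW/truncnS_gt.
have [J BJ] := Bw p; exists (2 ^ J)%N => // n /= Jn.
have n0 : (0 < n)%N by apply: leq_trans Jn; rewrite expn_gt0.
pose j := trunc_log 2 n.
have jJ : (J <= j)%N by exact: trunc_log_max.
have := BJ j jJ; rewrite sub0r normrN => nB.
have lt1 : `|psum Xs g 0 n w| < eta p * 2 ^+ j.
  rewrite ltNge; apply/negP => ge; apply: nB; exists n => //.
  exact/ltnW/trunc_log_ltn.
rewrite normrM normfV normr_nat ler_pdivrMr ?ltr0n//.
apply: (le_trans (ltW lt1)); apply: ler_pM => //; first exact: ltW.
by rewrite -natrX ler_nat trunc_logP.
Qed.

End LawOfLargeNumbers.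

Lemma normrX_le1D (R : realDomainType) (x : R) k m : (k <= m)%N ->
  `|x ^+ k| <= 1 + `|x| ^+ m.
Proof.
move=> km; rewrite normrX; have [x1|/ltW x1] := leP `|x| 1.
  by apply: (@le_trans _ _ 1); rewrite ?exprn_ile1// lerDl exprn_ge0.
by apply: (@le_trans _ _ (`|x| ^+ m)); rewrite ?lerDr// ler_weXn2l.
Qed.

Lemma L1_pow d (T : measurableType d) (R : realType) (P : probability T R)
    (f : T -> R) k m : measurable_fun [set: T] f -> (k <= m)%N ->
  L1 P (fun w => `|f w| ^+ m) -> L1 P (fun w => f w ^+ k).
Proof.
move=> mf km Lm; apply: (L1_le (g := fun w => 1 + `|f w| ^+ m)).
- exact: measurable_funX.
- by move=> w; exact: normrX_le1D.
- by apply: L1D => //; exact: L1_cst.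
Qed.

Section FourthMoment.
Context d (T : measurableType d) (R : realType) (P : probability T R).
Variables (X : {RV P >-> R}) (Xs : nat -> {RV P >-> R}).
Hypothesis X_iid : iid_samples X Xs.
Variable g : R -> R.
Hypothesis mg : measurable_fun [set: R] g.
Hypothesis Lg4 : L1 P (fun w => g (X w) ^+ 4).
Hypothesis g_mean0 : mean P (g \o X) = 0.

Let s2 := mean P (fun w => g (X w) ^+ 2).
Let m4 := mean P (fun w => g (X w) ^+ 4).
Let S n w := psum Xs g 0 n w.

Let Lgk k : (k <= 4)%N -> L1 P ((fun x => g x ^+ k) \o X).
Proof.
move=> k4; apply: (L1_pow _ k4) => /=; first exact: measurableT_comp.
by under eq_fun do rewrite -normrX ger0_norm ?exprn_even_ge0//.
Qed.

Let mgk k : measurable_fun [set: R] (fun x => g x ^+ k).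
Proof. exact: measurable_funX. Qed.

Let mS n : measurable_fun [set: T] (S n).
Proof. exact: measurable_psum. Qed.

Let SS n w : S n.+1 w = S n w + g (Xs n w).
Proof. by rewrite /S /psum big_nat_recr. Qed.

Let LS4 n : L1 P (fun w => S n w ^+ 4).
Proof.
elim: n => [|n IH].
  by rewrite /S /psum; under eq_fun do rewrite big_geq//; exact: L1_cst.
apply: (L1_le (g := fun w => 8 * (S n w ^+ 4 + g (Xs n w) ^+ 4))).
- exact/measurable_funX/mS.
- move=> w; rewrite SS ger0_norm ?exprn_even_ge0//.
  set a := S n w; set b := g _.
  (* The convexity bound (a + b)^4 <= 8 (a^4 + b^4), with an explicit nonnegative remainder. *)
  have -> : 8 * (a ^+ 4 + b ^+ 4) = (a + b) ^+ 4 + (a - b) ^+ 2 * (2 * (a ^+ 2 + b ^+ 2) + 5 * (a + b) ^+ 2).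
    by ring.
  by rewrite lerDl mulr_ge0 ?sqr_ge0// addr_ge0// mulr_ge0 ?addr_ge0 ?sqr_ge0.
- apply: L1Z; apply: L1D => //; exact: (iid_L1 X_iid n (mgk 4) (Lgk (leqnn 4))).
Qed.

Let LSk n k : (k <= 4)%N -> L1 P (fun w => S n w ^+ k).
Proof.
move=> k4; apply: (L1_pow _ k4) => //.
by under eq_fun do rewrite -normrX ger0_norm ?exprn_even_ge0//.
Qed.

Let prodE n j k : (j <= 4)%N -> (k <= 4)%N ->
  L1 P (fun w => S n w ^+ j * g (Xs n w) ^+ k) /\
  mean P (fun w => S n w ^+ j * g (Xs n w) ^+ k) =
  mean P (fun w => S n w ^+ j) * mean P (fun w => g (X w) ^+ k).
Proof.
move=> j4 k4; have aS : adapted Xs n (fun w => S n w ^+ j).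
  by apply: measurable_funX; apply: adapted_psum.
have [] := adapted_prod X_iid.1 (leqnn n) aS (mgk k) (LSk n j4)
  (iid_L1 X_iid n (mgk k) (Lgk k4)).
by rewrite (iid_mean X_iid n (mgk k) (Lgk k4)).
Qed.

Let g1 : mean P (fun w => g (X w) ^+ 1) = 0.
Proof. exact: g_mean0. Qed.

Let mean_S n : mean P (fun w => S n w ^+ 1) = 0.
Proof.
elim: n => [|n IH].
  by rewrite /S /psum; under eq_fun do rewrite big_geq// expr1; exact: mean_cst.
have [L mE] := @prodE n 0 1 isT isT.
have -> : (fun w => S n.+1 w ^+ 1) = (fun w => S n w ^+ 1 + S n w ^+ 0 * g (Xs n w) ^+ 1).
  by apply/funext => w; rewrite SS; ring.
by rewrite meanD//; [rewrite IH mE g1 mulr0 addr0|exact: LSk].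
Qed.

Let mean_S2 n : mean P (fun w => S n w ^+ 2) = n%:R * s2.
Proof.
elim: n => [|n IH].
  by rewrite /S /psum mul0r; under eq_fun do rewrite big_geq// expr0n/=; exact: mean_cst.
have [L1 m1] := @prodE n 1 1 isT isT.
have [L2 m2] := @prodE n 0 2 isT isT.
have -> : (fun w => S n.+1 w ^+ 2) = (fun w => (S n w ^+ 2 +
   2 * (S n w ^+ 1 * g (Xs n w) ^+ 1)) + S n w ^+ 0 * g (Xs n w) ^+ 2).
  by apply/funext => w; rewrite SS; ring.
have L3 := LSk n (isT : (2 <= 4)%N); have L4 := L1Z 2 L1.
rewrite meanD//; last exact: L1D.
rewrite meanD// meanZ// m1 m2 IH g1 !mulr0 addr0 -/s2.
under [X in _ + mean _ X * _]eq_fun do rewrite expr0.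
by rewrite mean_cst -natr1; ring.
Qed.

(** Only products in which no index occurs exactly once have nonzero mean, whence the exact value
    [n%:R * m4 + 3 * n%:R * (n%:R - 1) * s2 ^+ 2], obtained by adding one increment at a time. *)
Lemma mean_psum4 n : L1 P (fun w => S n w ^+ 4) /\
  mean P (fun w => S n w ^+ 4) <= (m4 + 3 * s2 ^+ 2) * n%:R ^+ 2.
Proof.
split => //.
have s20 : 0 <= s2 by apply: mean_ge0 => w; exact: sqr_ge0.
have m40 : 0 <= m4 by apply: mean_ge0 => w; exact: exprn_even_ge0.
suff -> : mean P (fun w => S n w ^+ 4) = n%:R * m4 + 3 * n%:R * (n%:R - 1) * s2 ^+ 2.
  case: n => [|n]; first by rewrite !(mul0r,mulr0,add0r) expr0n/= mulr0.
  have n1 : (1 : R) <= n.+1%:R by rewrite ler1n.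
  have h1 : 0 <= m4 * (n.+1%:R * (n.+1%:R - 1)).
    by rewrite !mulr_ge0// subr_ge0.
  have h2 : 0 <= s2 ^+ 2 * n.+1%:R by rewrite mulr_ge0// sqr_ge0.
  by lra.
elim: n => [|n IH].
  by rewrite /S /psum !(mul0r,mulr0,add0r); under eq_fun do rewrite big_geq// expr0n/=; exact: mean_cst.
have [L1 m1] := @prodE n 3 1 isT isT.
have [L2 m2] := @prodE n 2 2 isT isT.
have [L3 m3] := @prodE n 1 3 isT isT.
have [L4 m4'] := @prodE n 0 4 isT isT.
have -> : (fun w => S n.+1 w ^+ 4) = (fun w => (((S n w ^+ 4 +
   4 * (S n w ^+ 3 * g (Xs n w) ^+ 1)) + 6 * (S n w ^+ 2 * g (Xs n w) ^+ 2))
   + 4 * (S n w ^+ 1 * g (Xs n w) ^+ 3)) + S n w ^+ 0 * g (Xs n w) ^+ 4).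
  by apply/funext => w; rewrite SS; ring.
have K0 := LS4 n; have K1 := L1Z 4 L1; have K2 := L1Z 6 L2; have K3 := L1Z 4 L3.
have D1 := L1D K0 K1; have D2 := L1D D1 K2; have D3 := L1D D2 K3.
rewrite meanD// meanD// meanD// meanD// m4' !meanZ// m1 m2 m3 IH g1 mean_S mean_S2.
under [X in _ + mean _ X * _]eq_fun do rewrite expr0.
by rewrite mean_cst -natr1 -/s2 -/m4; ring.
Qed.

(** For [a] proportional to [n] this is of order 1 / n^2, hence summable; the second moment would
    give 1 / n only. *)
Lemma psum_fourth_moment_tail a n : 0 < a ->
  pr P [set w | a <= `|S n w|] <= (m4 + 3 * s2 ^+ 2) * n%:R ^+ 2 / a ^+ 4.
Proof.
move=> a0; have [LT mT] := mean_psum4 n.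
have S40 w : 0 <= S n w ^+ 4 by exact: exprn_even_ge0.
have := markov_mean LT S40 (exprn_gt0 4 a0).
move=> h; apply: (@le_trans _ _ (pr P [set w | a ^+ 4 <= S n w ^+ 4])).
  apply: le_pr; first exact: measurable_exceeds.
    rewrite -[X in measurable X]setTI; apply: measurable_fun_le => //.
    exact: L1_measurable LT.
  move=> w /= aS; rewrite -[leRHS]ger0_norm// normrX.
  by rewrite lerXn2r// nnegrE ltW.
apply: (le_trans h); rewrite mulrC ler_wpM2r// invr_ge0 exprn_even_ge0//.
Qed.

End FourthMoment.

(** * Central limit theorem *)

Section Taylor.
Variable R : realType.
Implicit Types (f : R -> R) (a b : R).

Lemma mean_value f (df : R -> R) a b : (forall x : R, is_derive x 1 f (df x)) ->
  exists2 c, Num.min a b <= c <= Num.max a b & f b - f a = df c * (b - a).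
Proof.
move=> fd; wlog ab : a b / a <= b.
  move=> H; have /orP[/H//|/H[c cab e]] := le_total a b.
  by exists c; [rewrite minC maxC|rewrite -opprB e -mulrN opprB].
have cf : {within `[a, b], continuous f}.
  apply: continuous_subspaceT => x; apply: differentiable_continuous.
  by apply/derivable1_diffP; have [] := fd x.
have [c cab e] := MVT_segment ab (fun x _ => fd x) cf.
by exists c => //; rewrite min_l// max_r//; move: cab; rewrite in_itv.
Qed.

Lemma between_dist (a b c : R) : Num.min a b <= c <= Num.max a b -> `|c - a| <= `|b - a|.
Proof.
rewrite [`|c - a| <= _]ler_norml; have [ab|/ltW ab] := leP a b => /andP[h1 h2].
  by rewrite ger0_norm ?subr_ge0//; apply/andP; split; lra.
by rewrite ler0_norm ?subr_le0//; apply/andP; split; lra.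
Qed.

(** The mean value theorem used twice, hence the constant [M] instead of [M / 2]. The bound on [ddf]
    is asked only between [a] and [b], which matters in [Phi_rescale], where [M] depends on the
    endpoints. *)
Lemma taylor1 f (df ddf : R -> R) (M : R) a b :
  (forall x : R, is_derive x 1 f (df x)) -> (forall x : R, is_derive x 1 df (ddf x)) ->
  (forall c, Num.min a b <= c <= Num.max a b -> `|ddf c| <= M) ->
  `|f b - f a - df a * (b - a)| <= M * (b - a) ^+ 2.
Proof.
move=> fd dfd ddfM; have [c cab ->] := mean_value a b fd.
have [e eac dfe] := mean_value a c dfd.
have eab : Num.min a b <= e <= Num.max a b.
  by move: cab eac; case: (leP a b) => ? /andP[h1 h2]; case: (leP a c) => ? /andP[h3 h4];
     apply/andP; split; lra.
rewrite -mulrBl dfe !normrM -[(b - a) ^+ 2]ger0_norm ?sqr_ge0// normrX expr2 mulrA.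
rewrite ler_wpM2r//; apply: ler_pM => //; first exact: ddfM.
exact: between_dist.
Qed.

(** The mean value theorem is applied to [G], whose derivative is the first-order remainder of [df],
    controlled by [taylor1]. *)
Lemma taylor2 f (df ddf dddf : R -> R) (M : R) a b :
  (forall x : R, is_derive x 1 f (df x)) -> (forall x : R, is_derive x 1 df (ddf x)) ->
  (forall x : R, is_derive x 1 ddf (dddf x)) -> (forall c, `|dddf c| <= M) ->
  `|f b - f a - df a * (b - a) - 2^-1 * ddf a * (b - a) ^+ 2| <= M * `|b - a| ^+ 3.
Proof.
move=> fd dfd ddfd dM.
pose G (x : R) := f x - df a * x - 2^-1 * ddf a * (x - a) ^+ 2.
have Gd (x : R) : is_derive x 1 G (df x - df a - ddf a * (x - a)).
  rewrite /G; have := fd x => ?; apply: is_derive_eq.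
  by rewrite -![_ *: _]/(_ * _); field.
have [c cab e] := mean_value a b Gd.
have -> : f b - f a - df a * (b - a) - 2^-1 * ddf a * (b - a) ^+ 2 = G b - G a.
  by rewrite /G subrr expr0n/= mulr0; ring.
rewrite e normrM; have h := taylor1 dfd ddfd (fun c _ => dM c) (a := a) (b := c).
have hc := between_dist cab.
rewrite exprSr mulrA ler_wpM2r//; apply: (le_trans h).
have M0 : 0 <= M by apply: le_trans (dM a).
rewrite ler_wpM2l// -(real_normK (num_real (c - a))) lerXn2r// nnegrE//.
Qed.

End Taylor.

(** * The standard normal density and distribution function *)

Section Normal.
Variable R : realType.

Let Phi : R -> R := @stdnormal_cdf R.
Definition phi (x : R) : R := normal_pdf 0 1 x.

Lemma phiE x : phi x = normal_peak 1 * expR (- (x ^+ 2 / 2)).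
Proof.
rewrite /phi normal_pdfE ?oner_eq0// /normal_fun subr0 expr1n.
by rewrite mulNr.
Qed.

Lemma normal_peak1 : 0 < normal_peak (1 : R) <= 1.
Proof.
rewrite normal_peak_gt0 ?oner_eq0//= /normal_peak expr1n mul1r.
have pi2 : (0 : R) < pi *+ 2 by rewrite pmulrn_lgt0// pi_gt0.
rewrite invf_le1 ?sqrtr_gt0// -[leLHS]sqrtr1 ler_sqrt ?ltW//.
have := @pi_ge2 R; rewrite mulr2n; lra.
Qed.

Lemma phi_gt0 x : 0 < phi x.
Proof. by rewrite phiE mulr_gt0 ?expR_gt0//; case/andP: normal_peak1. Qed.

Lemma phiN x : phi (- x) = phi x. Proof. by rewrite !phiE sqrrN. Qed.

(** The constant is 1 + 16: [|x| ^+ j] is at most 1 + x^4, while [E], the inverse of the exponential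
    factor, dominates both 1 and x^4 / 16. *)
Lemma norm_pow_phi j x : (j <= 4)%N -> `|x| ^+ j * phi x <= 17.
Proof.
move=> j4; have /andP[p0 p1] := normal_peak1.
pose E := expR (x ^+ 2 / 2).
have E0 : 0 < E by exact: expR_gt0.
have y0 : 0 <= x ^+ 2 / 4 by rewrite divr_ge0// sqr_ge0.
have E1 : 1 <= E by rewrite /E -expR0 ler_expR divr_ge0// sqr_ge0.
have E4 : x ^+ 4 / 16 <= E.
  have -> : E = expR (x ^+ 2 / 4) ^+ 2 by rewrite /E [RHS]expr2 -expRD; congr expR; lra.
  have -> : x ^+ 4 / 16 = (x ^+ 2 / 4) ^+ 2 by field.
  rewrite lerXn2r ?nnegrE ?expR_ge0//.
  by apply: le_trans (expR_ge1Dx _); rewrite lerDr.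
have -> : `|x| ^+ j * phi x = (`|x| ^+ j * normal_peak 1) / E.
  by rewrite phiE expRN mulrA.
rewrite ler_pdivrMr//; apply: (@le_trans _ _ (`|x| ^+ j)); first by rewrite ler_piMr.
have := normrX_le1D x j4; rewrite normrX => h; apply: (le_trans h).
by rewrite -normrX ger0_norm ?exprn_even_ge0//; lra.
Qed.

Lemma phi_derive (x : R) : is_derive x 1 phi (- x * phi x).
Proof.
have -> : phi = (fun x => normal_peak 1 * expR (- (x ^+ 2 / 2))).
  by apply/funext => y; rewrite phiE.
apply: is_derive_eq; rewrite /GRing.scale/=; by field.
Qed.

Lemma phi_derive2 (x : R) : is_derive x 1 (fun x => - x * phi x) ((x ^+ 2 - 1) * phi x).
Proof.
have h := phi_derive x; apply: is_derive_eq; rewrite /GRing.scale/=; ring.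
Qed.

Lemma Phi_derive (x : R) : is_derive x 1 Phi (phi x).
Proof.
have [||||dF FE] := @continuous_FTC1 R phi -oo%O x (x + 1).
- by rewrite ltrDl.
- apply: integrableS (integrable_normal_pdf 0 1) => //.
- by rewrite ltNyr.
- by apply: continuous_normal_pdf; exact: oner_neq0.
by have := derivableP dF; rewrite -derive1E FE; exact.
Qed.

Lemma Phi_lipschitz x y :
  `|Phi x - Phi y| <= 17 * `|x - y|.
Proof.
have [c _ ->] := mean_value y x Phi_derive.
rewrite normrM ler_wpM2r// (ger0_norm (ltW (phi_gt0 c))).
by have := @norm_pow_phi 0 c isT; rewrite mul1r.
Qed.

Lemma continuous_Phi : continuous Phi.
Proof.
move=> x; apply: differentiable_continuous; apply/derivable1_diffP.
by have [] := Phi_derive x.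
Qed.

Let mid : measurable_fun [set: measurableTypeR R] (fun x : measurableTypeR R => x : R).
Proof. exact: measurable_id. Qed.

(** Under the normal law the identity has [Phi] as its distribution function, which gives the limits
    of [Phi] at infinity. *)
Let idR : {RV @normal_prob R 0 1 >-> R} :=
  HB.pack (fun x : R => x) (isMeasurableFun.Build _ _ _ _ _ mid).

Lemma Phi_cdf x : Phi x = fine (cdf idR x). Proof. by []. Qed.

Lemma Phi_ge0 x : 0 <= Phi x. Proof. exact: fine_ge0. Qed.

Lemma Phi_le1 x : Phi x <= 1.
Proof. by rewrite Phi_cdf -lee_fin fineK ?cdf_le1// fin_num_measure. Qed.

Lemma Phi_cvgy : Phi x @[x --> +oo] --> (1 : R).
Proof. by have /fine_cvgP[] := cvg_cdfy1 idR. Qed.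

Lemma Phi_cvgNy : Phi x @[x --> -oo] --> (0 : R).
Proof. by have /fine_cvgP[] := cvg_cdfNy0 idR. Qed.

Lemma Phi_lt x y : x < y -> Phi x < Phi y.
Proof.
move=> xy; have [c _ e] := mean_value x y Phi_derive.
by rewrite -subr_gt0 e mulr_gt0 ?phi_gt0// subr_gt0.
Qed.

Lemma ltr_Phi x y : (Phi x < Phi y) = (x < y).
Proof.
apply/idP/idP => [|/Phi_lt//]; apply: contraTT; rewrite -!leNgt le_eqVlt.
by case/predU1P => [->//|/Phi_lt/ltW].
Qed.

Lemma ler_Phi x y : (Phi x <= Phi y) = (x <= y).
Proof. by rewrite !leNgt ltr_Phi. Qed.

(** The sum of [Phi x] and [Phi (- x)] has derivative 0, because [phi] is even, and tends to 1 at
    infinity. *)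
Lemma PhiN x : Phi (- x) = 1 - Phi x.
Proof.
pose H (x : R) := Phi x + Phi (- x).
have Hd (y : R) : is_derive y 1 H 0.
  have h1 := Phi_derive y; have h2 := Phi_derive (- y).
  apply: is_derive_eq; rewrite /GRing.scale/= phiN; ring.
have Hc y : H x = H y by apply: is_derive_0_is_cst.
have : H y @[y --> +oo] --> (1 + 0 : R).
  apply: cvgD; first exact: Phi_cvgy.
  by have := Phi_cvgNy; rewrite cvgNy_compNP.
have -> : H = cst (H x) by apply/funext => y; rewrite (Hc y).
move=> /(cvg_unique _ (cvg_cst _)) => /(_ _)/=.
rewrite addr0 /H => /(_ (@norm_hausdorff _ _)) e; lra.
Qed.

Lemma Phi0 : Phi 0 = 2^-1.
Proof. by have := PhiN 0; rewrite oppr0; lra. Qed.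

(** The limits at both infinities and the intermediate value theorem put [p] in the range of [Phi],
    where the partial inverse is a right inverse. *)
Lemma Phi_quantile p : 0 < p < 1 -> Phi (stdnormal_quantile p) = p.
Proof.
move=> /andP[p0 p1]; rewrite /stdnormal_quantile.
have [b pb] : exists b, p <= Phi b.
  have := Phi_cvgy => /cvgrPdist_lt/(_ (1 - p)); rewrite subr_gt0 => /(_ p1) [M [_ MP]].
  exists (M + 1); have := MP (M + 1); rewrite ltrDl ltr01 => /(_ isT).
  by rewrite /= ger0_norm ?subr_ge0 ?Phi_le1//; lra.
have [a pa] : exists a, Phi a <= p.
  have := Phi_cvgNy => /cvgrPdist_lt/(_ p p0) [M [_ MP]].
  exists (M - 1); have := MP (M - 1); rewrite ltrBlDr ltrDl ltr01 => /(_ isT).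
  by rewrite /= sub0r normrN ger0_norm ?Phi_ge0// => /ltW.
have ab : a <= b by rewrite -ler_Phi (le_trans pa).
have [|c _ Pc] := @IVT R Phi a b p ab (continuous_subspaceT continuous_Phi).
  by rewrite min_l ?max_r ?ler_Phi// pa.
by apply: (@pinvK R R 0 [set: R] Phi p); rewrite inE; exists c.
Qed.

End Normal.

Section HeatStep.
Variable R : realType.
Let Phi : R -> R := @stdnormal_cdf R.

Lemma Phi_taylor2 (z w : R) :
  `|Phi (z - w) - Phi z + phi z * w + 2^-1 * (z * phi z) * w ^+ 2| <= 34 * `|w| ^+ 3.
Proof.
(* A bound for the third derivative of [Phi]: c^2 phi(c) and phi(c) are each at most 17. *)
have B (c : R) : `|(c ^+ 2 - 1) * phi c| <= 34.
  have h0 := phi_gt0 c; have h1 := @norm_pow_phi R 2 c isT.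
  have h2 := @norm_pow_phi R 0 c isT; move: h1 h2; rewrite real_normK ?num_real// expr0 mul1r.
  have h3 : 0 <= c ^+ 2 * phi c by rewrite mulr_ge0 ?sqr_ge0 ?ltW.
  by rewrite ler_norml; set q := c ^+ 2 * _ in h3 *; rewrite mulrBl mul1r -/q; lra.
have := taylor2 z (z - w) (@Phi_derive R) (@phi_derive R) (@phi_derive2 R) B.
rewrite (_ : z - w - z = - w); last by ring.
rewrite normrN; congr (_ <= _); congr `|_|; rewrite /Phi; ring.
Qed.

(* Up to O(1/s^2), rescaling the variance from s to s + 1 has the effect of
   adding an independent variable of variance 1: the heat equation. *)
Lemma Phi_rescale (y s z : R) : 1 <= s -> z = y / Num.sqrt s ->
  `|Phi (y / Num.sqrt (s + 1)) - Phi z + 2^-1 * (z * phi z) / s| <= 51 / s ^+ 2.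
Proof.
move=> s1 zE; have s0 : 0 < s by lra.
set q := Num.sqrt s; set q' := Num.sqrt (s + 1).
have q0 : 0 < q by rewrite sqrtr_gt0.
have q'0 : 0 < q' by rewrite sqrtr_gt0; lra.
have q2 : q ^+ 2 = s by rewrite sqr_sqrtr// ltW.
have q'2 : q' ^+ 2 = s + 1 by rewrite sqr_sqrtr//; lra.
have qq' : q <= q' by rewrite ler_sqrt; lra.
(* Rescaling replaces the argument [z] by [z * r], where [r] is 1 - 1 / (2 s) up to O(1 / s^2). *)
pose r := q / q'.
have r0 : 0 < r by rewrite divr_gt0.
have r1 : r <= 1 by rewrite ler_pdivrMr// mul1r.
have r2 : r ^+ 2 = s / (s + 1) by rewrite expr_div_n q2 q'2.
have zr : y / q' = z * r by rewrite zE /r -/q; field; rewrite !gt_eqF.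
have r2h : 2^-1 <= r ^+ 2 by rewrite r2 ler_pdivlMr; lra.
have d0 : 0 <= 1 - r by lra.
have dr : (1 - r) * (1 + r) = (s + 1)^-1.
  have -> : (1 - r) * (1 + r) = 1 - r ^+ 2 by ring.
  by rewrite r2; field; lra.
have d1 : 1 - r <= s^-1.
  apply: (@le_trans _ _ (s + 1)^-1); last by rewrite lef_pV2 ?posrE; lra.
  by rewrite -dr ler_peMr//; lra.
have d2 : (1 - r) ^+ 2 <= s ^- 2.
  by rewrite -exprVn lerXn2r// nnegrE ?invr_ge0//; lra.
rewrite zr.
(* The estimate must be uniform in [z]. Between [z * r] and [z] one has z^2 <= 2 c^2, so the bound
   on |c|^3 phi(c) makes the second derivative at most 34 / z^2, and the z^2 of the squared
   increment cancels. *)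
have T : `|Phi (z * r) - Phi z - phi z * (z * r - z)| <= 34 * (1 - r) ^+ 2.
  have [z0|z0] := eqVneq z 0.
    by rewrite z0 !mul0r !subrr mulr0 subrr normr0 mulr_ge0// sqr_ge0.
  have z20 : 0 < z ^+ 2 by rewrite exprn_even_gt0.
  have -> : 34 * (1 - r) ^+ 2 = (34 / z ^+ 2) * (z * r - z) ^+ 2.
    by field.
  apply: (taylor1 (@Phi_derive R) (@phi_derive R)) => c cb.
  have zc : z ^+ 2 <= 2 * c ^+ 2.
    apply: (@le_trans _ _ (2 * (z * r) ^+ 2)).
      by rewrite exprMn; have := ler_wpM2l (ltW z20) r2h; lra.
    rewrite ler_wpM2l// -(real_normK (num_real (z * r))) -(real_normK (num_real c)).
    rewrite lerXn2r// ?nnegrE//.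
    move: cb; have [zs|zs] := leP 0 z.
      have h : z * r <= z by rewrite ler_piMr.
      have h' : 0 <= z * r by rewrite mulr_ge0// ltW.
      by rewrite min_r// max_l// => /andP[c1 c2]; rewrite !ger0_norm//; lra.
    have h : z <= z * r by rewrite -[leLHS]mulr1 ler_wnM2l// ltW.
    have h' : z * r <= 0 by rewrite pmulr_lle0// ltW.
    by rewrite min_l// max_r// => /andP[c1 c2]; rewrite !ler0_norm//; lra.
  rewrite normrM normrN (ger0_norm (ltW (phi_gt0 c))) ler_pdivlMr//.
  have h3 := @norm_pow_phi R 3 c isT.
  apply: (@le_trans _ _ (`|c| * phi c * (2 * c ^+ 2))).
    by rewrite ler_wpM2l// mulr_ge0// ltW// phi_gt0.
  rewrite -(real_normK (num_real c)).
  have -> : `|c| * phi c * (2 * `|c| ^+ 2) = 2 * (`|c| ^+ 3 * phi c) by ring.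
  lra.
have D : `|1 - r - (2 * s)^-1| <= s ^- 2.
  have -> : 1 - r - (2 * s)^-1 = - ((1 + r - s * (1 - r)) / (2 * s * (s + 1) * (1 + r))).
    rewrite {1}(_ : 1 - r = (s + 1)^-1 / (1 + r)); last by rewrite -dr; field; lra.
    by field; rewrite !gt_eqF//; lra.
  have sd : s * (1 - r) <= 1 by rewrite mulrC -ler_pdivlMr// mul1r.
  have sd0 : 0 <= s * (1 - r) by rewrite mulr_ge0// ltW.
  rewrite normrN ger0_norm; last first.
    by rewrite divr_ge0//; [lra|rewrite !mulr_ge0//; lra].
  rewrite ler_pdivrMr; last by rewrite !mulr_gt0//; lra.
  apply: (@le_trans _ _ 2); first by lra.
  have -> : s ^- 2 * (2 * s * (s + 1) * (1 + r)) = 2 * ((1 + s^-1) * (1 + r)).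
    by field; rewrite gt_eqF.
  rewrite -[leLHS]mulr1 ler_wpM2l//.
  have : 0 < s^-1 by rewrite invr_gt0.
  set i := s^-1 => i0; have : 0 <= i * r by rewrite mulr_ge0// ltW.
  by rewrite mulrDl mul1r mulrDr mulr1; lra.
have zphi : `|z * phi z| <= 17.
  rewrite normrM (ger0_norm (ltW (phi_gt0 z))).
  by have := @norm_pow_phi R 1 z isT; rewrite expr1.
(* The constant 51 is 34 from the Taylor remainder plus 17 from replacing 1 - r by 1 / (2 s). *)
have -> : Phi (z * r) - Phi z + 2^-1 * (z * phi z) / s =
  (Phi (z * r) - Phi z - phi z * (z * r - z)) - (z * phi z) * (1 - r - (2 * s)^-1).
  by field; rewrite gt_eqF.
apply: (le_trans (ler_normB _ _)); rewrite normrM.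
have h1 : `|z * phi z| * `|1 - r - (2 * s)^-1| <= 17 * s ^- 2 by exact: ler_pM.
have h2 : 34 * (1 - r) ^+ 2 <= 34 * s ^- 2 by rewrite ler_wpM2l.
by apply: (le_trans (lerD (le_trans T h2) h1)); rewrite -mulrDl ler_wpM2r ?invr_ge0 ?sqr_ge0//; lra.
Qed.

End HeatStep.

Section CentralLimit.
Context d (T : measurableType d) (R : realType) (P : probability T R).
Variables (X : {RV P >-> R}) (Xs : nat -> {RV P >-> R}).
Hypothesis X_iid : iid_samples X Xs.
Variable g : R -> R.
Hypothesis mg : measurable_fun [set: R] g.
Hypothesis Lg3 : L1 P (fun w => `|g (X w)| ^+ 3).
Hypothesis g_mean0 : mean P (g \o X) = 0.
Hypothesis g_var1 : mean P (fun w => g (X w) ^+ 2) = 1.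

Let Phi : R -> R := @stdnormal_cdf R.
Let S n w := psum Xs g 0 n w.
Let K := 34 * mean P (fun w => `|g (X w)| ^+ 3) + 51.

Let K0 : 0 < K.
Proof.
by rewrite /K ltr_wpDl// mulr_ge0// mean_ge0// => w; rewrite exprn_ge0.
Qed.

Let mS n : measurable_fun [set: T] (S n).
Proof. exact: measurable_psum. Qed.

Let measurable_Phi : measurable_fun [set: R] Phi.
Proof. apply: continuous_measurable_fun; exact: continuous_Phi. Qed.

Let measurable_phi : measurable_fun [set: R] (@phi R).
Proof. exact: measurable_normal_pdf. Qed.

Let L1_Phi (f : T -> R) : measurable_fun [set: T] f -> L1 P (fun w => Phi (f w)).
Proof.
move=> mf; apply: (L1_le (g := fun=> 1)).
- exact: measurableT_comp.
- by move=> w; rewrite ger0_norm ?Phi_ge0// Phi_le1.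
- exact: L1_cst.
Qed.

(** Both terms are expanded around [Phi (z w)]. The linear term in the increment has mean zero; the
    quadratic term has, by unit variance, the same mean as the first-order effect of passing from
    [s] to [s + 1]. What remains is of third order. *)
Lemma clt_step (b s : R) n : 1 <= s ->
  `|mean P (fun w => Phi ((b - S n.+1 w) / Num.sqrt s)) -
    mean P (fun w => Phi ((b - S n w) / Num.sqrt (s + 1)))| <= K / (s * Num.sqrt s).
Proof.
move=> s1; have s0 : 0 < s by lra.
set q := Num.sqrt s.
have q0 : 0 < q by rewrite sqrtr_gt0.
have q2 : q ^+ 2 = s by rewrite sqr_sqrtr// ltW.
pose z w := (b - S n w) / q.
pose xi w := g (Xs n w).
have az : adapted Xs n z.
  by apply: measurable_funM => //; apply: measurable_funB => //; apply: adapted_psum.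
have ap : adapted Xs n (fun w => phi (z w)) by exact: measurableT_comp.
have azp : adapted Xs n (fun w => z w * phi (z w)) by exact: measurable_funM.
have Lp : L1 P (fun w => phi (z w)).
  apply: (L1_le (g := fun=> 17)); [exact: adapted_measurable ap| |exact: L1_cst].
  move=> w; rewrite ger0_norm ?(ltW (phi_gt0 _))//.
  by have := @norm_pow_phi R 0 (z w) isT; rewrite mul1r.
have Lzp : L1 P (fun w => z w * phi (z w)).
  apply: (L1_le (g := fun=> 17)); [exact: adapted_measurable azp| |exact: L1_cst].
  move=> w; rewrite normrM (ger0_norm (ltW (phi_gt0 _))).
  exact: (@norm_pow_phi R 1 (z w) isT).
have mX : measurable_fun [set: T] (fun w => g (X w)) by exact: measurableT_comp.
have Lg1 : L1 P (g \o X) by exact: (@L1_pow _ _ _ _ _ 1 3).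
have Lg2 : L1 P ((fun x => g x ^+ 2) \o X) by exact: (@L1_pow _ _ _ _ _ 2 3).
have mg2 : measurable_fun [set: R] (fun x => g x ^+ 2) by exact: measurable_funX.
have mg3 : measurable_fun [set: R] (fun x => `|g x| ^+ 3).
  by apply: measurable_funX; exact: measurableT_comp.
have [LA mA] := adapted_prod X_iid.1 (leqnn n) ap mg Lp (iid_L1 X_iid n mg Lg1).
have [LB mB] := adapted_prod X_iid.1 (leqnn n) azp mg2 Lzp (iid_L1 X_iid n mg2 Lg2).
have L3 := iid_L1 X_iid n mg3 Lg3.
rewrite (iid_mean X_iid) // g_mean0 mulr0 in mA.
rewrite (iid_mean X_iid) // g_var1 mulr1 in mB.
pose F1 w := Phi ((b - S n.+1 w) / q).
pose F0 w := Phi ((b - S n w) / Num.sqrt (s + 1)).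
have L1F : L1 P F1 by apply: L1_Phi; apply: measurable_funM => //; apply: measurable_funB.
have L0F : L1 P F0 by apply: L1_Phi; apply: measurable_funM => //; apply: measurable_funB.
pose B w := z w * phi (z w) * xi w ^+ 2 - z w * phi (z w).
have LBB : L1 P B by exact: L1B.
have mB0 : mean P B = 0 by rewrite /B meanB// mB subrr.
(* The added corrections have mean zero, so [D] has the mean of [F1 - F0], but pointwise it is as
   small as the two remainders. *)
pose D w := F1 w - F0 w + (q^-1 * (phi (z w) * xi w) + (2 * s)^-1 * B w).
have LD : L1 P D.
  by apply: L1D; [exact: L1B|apply: L1D; exact: L1Z].
have mD : mean P D = mean P F1 - mean P F0.
  have LL := L1B L1F L0F; have LA' := L1Z q^-1 LA; have LB' := L1Z (2 * s)^-1 LBB.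
  rewrite /D meanD//; last exact: L1D.
  by rewrite meanB// meanD// !meanZ// mA mB0 !mulr0 !addr0.
rewrite -/F1 -/F0 -mD; apply: (le_trans (le_norm_mean LD)).
pose M w := (s * q)^-1 * (34 * `|xi w| ^+ 3 + 51).
have LM : L1 P M by apply: L1Z; apply: L1D; [exact: L1Z|exact: L1_cst].
have -> : K / (s * q) = mean P M.
  rewrite /M meanZ; last by apply: L1D; [exact: L1Z|exact: L1_cst].
  rewrite meanD; [|exact: L1Z|exact: L1_cst].
  by rewrite meanZ// mean_cst (iid_mean X_iid n mg3 Lg3) mulrC.
apply: le_mean => //; first exact: L1_norm.
move=> w; have h1 := Phi_taylor2 (z w) (xi w / q).
have h2 : `|F0 w - Phi (z w) + 2^-1 * (z w * phi (z w)) / s| <= 51 / s ^+ 2.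
  exact: Phi_rescale.
have E1 : F1 w = Phi (z w - xi w / q).
  by rewrite /z /xi /F1 /S /psum big_nat_recr//=; congr Phi; field; rewrite gt_eqF.
have -> : D w = (Phi (z w - xi w / q) - Phi (z w) + phi (z w) * (xi w / q) +
    2^-1 * (z w * phi (z w)) * (xi w / q) ^+ 2) -
    (F0 w - Phi (z w) + 2^-1 * (z w * phi (z w)) / s).
  by rewrite /D E1 /B expr_div_n q2; field; rewrite !gt_eqF.
apply: (le_trans (ler_normB _ _)); apply: (le_trans (lerD h1 h2)).
rewrite /M mulrDr; apply: lerD.
  rewrite normrM exprMn normfV (gtr0_norm q0).
  rewrite le_eqVlt; apply/orP; left; apply/eqP.
  by rewrite -q2; field; rewrite gt_eqF.
rewrite mulrC ler_wpM2r// lef_pV2 ?posrE ?mulr_gt0 ?exprn_gt0// expr2 ler_wpM2l ?(ltW s0)//.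
rewrite -q2 expr2 ler_peMl ?(ltW q0)//.
by rewrite -[leLHS]sqrtr1 /q ler_sqrt// ltW.
Qed.

(** One increment is traded at a time while [s] grows by 1; the error of a step decreases in [s], so
    every step is charged that of the first. *)
Lemma clt_smooth (b : R) k (s : R) : 1 <= s ->
  `|mean P (fun w => Phi ((b - S k w) / Num.sqrt s)) - Phi (b / Num.sqrt (s + k%:R))|
  <= k%:R * (K / (s * Num.sqrt s)).
Proof.
elim: k s => [|k IH] s s1.
  rewrite addr0 mul0r /S /psum; under eq_fun do rewrite big_geq// subr0.
  by rewrite mean_cst subrr normr0.
have h1 := clt_step b k s1.
have h2 := IH (s + 1) ltac:(lra).
rewrite (_ : s + k.+1%:R = s + 1 + k%:R); last by rewrite -natr1; ring.
rewrite -natr1.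
move: h1 h2; set x := mean P _; set y := mean P _; set z := Phi _ => h1 h2.
have -> : x - z = (x - y) + (y - z) by ring.
apply: (le_trans (ler_normD _ _)); rewrite mulrDl mul1r addrC.
apply: lerD => //; apply: (le_trans h2).
rewrite ler_wpM2l// ler_wpM2l ?(ltW K0)//.
have q0 : 0 < Num.sqrt s by rewrite sqrtr_gt0; lra.
have qq : Num.sqrt s <= Num.sqrt (s + 1) by rewrite ler_sqrt; lra.
rewrite lef_pV2 ?posrE; first by apply: ler_pM => //; lra.
  by rewrite mulr_gt0//; lra.
by rewrite mulr_gt0//; lra.
Qed.

(** Here s = n a^4, so for small [a] the smoothing adds only a small fraction of the variance; [n]
    steps of error K / s^(3/2) cost K / (a^6 sqrt n). *)
Let smoothing (a : R) n (b : R) : 0 < a -> 1 <= n%:R * a ^+ 4 ->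
  `|mean P (fun w => Phi ((b * Num.sqrt n%:R - S n w) / (a ^+ 2 * Num.sqrt n%:R))) -
    Phi (b / Num.sqrt (1 + a ^+ 4))| <= K / (a ^+ 6 * Num.sqrt n%:R).
Proof.
move=> a0 na; have n0 : (0 : R) < n%:R.
  by move: na; rewrite ltr0n; case: n => //; rewrite mul0r ler10.
have q0 : 0 < Num.sqrt (n%:R : R) by rewrite sqrtr_gt0.
have qE : Num.sqrt (n%:R * a ^+ 4) = a ^+ 2 * Num.sqrt n%:R.
  rewrite sqrtrM ?ler0n// mulrC; congr (_ * _).
  by rewrite (_ : a ^+ 4 = (a ^+ 2) ^+ 2) ?sqrtr_sqr ?ger0_norm ?sqr_ge0// -exprM.
have := clt_smooth (b * Num.sqrt n%:R) n na.
have -> : n%:R * a ^+ 4 + n%:R = n%:R * (1 + a ^+ 4) by ring.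
rewrite qE sqrtrM ?ler0n// => h.
have -> : b / Num.sqrt (1 + a ^+ 4) =
    b * Num.sqrt n%:R / (Num.sqrt n%:R * Num.sqrt (1 + a ^+ 4)).
  field; rewrite !gt_eqF// sqrtr_gt0 ltr_wpDr// exprn_ge0// ltW//.
apply: (le_trans h); rewrite le_eqVlt; apply/orP; left; apply/eqP.
by field; rewrite !gt_eqF.
Qed.

(** The smoothed function is a blurred indicator of width a^2 sqrt n. Moving its edge by a sqrt n,
    that is by 1 / a widths, sandwiches the true indicator up to 1 - Phi(1 / a). The closed event is
    bounded above and the open one below, so each bound covers the other event as well. *)
Lemma central_limit (c e : R) : 0 < e ->
  \forall n \near \oo,
    pr P [set w | S n w <= c * Num.sqrt n%:R] <= Phi c + e /\
    Phi c - e <= pr P [set w | S n w < c * Num.sqrt n%:R].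
Proof.
move=> e0.
have [a [a0 [ha1 ha2 ha3]]] : exists a : R, 0 < a /\
    [/\ Phi ((c + a) / Num.sqrt (1 + a ^+ 4)) <= Phi c + e / 3,
     Phi c - e / 3 <= Phi ((c - a) / Num.sqrt (1 + a ^+ 4)) &
     1 - Phi a^-1 <= e / 3].
  pose h (a : R) := Phi ((c + a) / Num.sqrt (1 + a ^+ 4)).
  have hc : h a @[a --> 0] --> Phi c.
    have -> : Phi c = h 0 by rewrite /h expr0n/= !addr0 sqrtr1 divr1.
    apply: (@continuous_comp _ _ _ (fun a : R => (c + a) / Num.sqrt (1 + a ^+ 4)) Phi).
      apply: cvgM; first by apply: cvgD; [exact: cvg_cst|exact: cvg_id].
      apply: cvgV; first by rewrite expr0n/= addr0 sqrtr1 oner_neq0.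
      apply: (@continuous_comp _ _ _ (fun a : R => 1 + a ^+ 4) Num.sqrt).
        by apply: cvgD; [exact: cvg_cst|exact: exprn_continuous].
      exact: sqrt_continuous.
    exact: continuous_Phi.
  have e30 : 0 < e / 3 by lra.
  move/cvgrPdist_le : hc => /(_ _ e30) /nbhs_ballP[r /= r0 rP].
  have := @Phi_cvgy R => /cvgrPdist_le/(_ _ e30)[M [_ MP]].
  (* Small enough for the continuity of [h] at 0, and with 1 / a beyond the point where [Phi] is
     within e / 3 of 1. *)
  pose a := Num.min (r / 2) (`|M| + 1)^-1.
  have M0 : 0 < `|M| + 1 by rewrite ltr_wpDl.
  have a0 : 0 < a by rewrite lt_min invr_gt0 M0 andbT; lra.
  have ar : a < r by rewrite /a gt_min; apply/orP; left; lra.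
  exists a; split => //; split.
  - have := rP a; rewrite /ball /= sub0r normrN gtr0_norm// => /(_ ar).
    by rewrite /h ler_norml => /andP[]; lra.
  (* As a^4 is even in [a], the lower shift is [h] at [- a]. *)
  - have := rP (- a); rewrite /ball /= sub0r !normrN gtr0_norm// => /(_ ar).
    by rewrite /h (_ : (- a) ^+ 4 = a ^+ 4) ?ler_norml; [move=> /andP[]; lra|ring].
  - have /MP : M < a^-1.
    apply: (@lt_le_trans _ _ (`|M| + 1)); first by have := ler_norm M; lra.
    by rewrite -[leLHS]invrK lef_pV2 ?posrE ?invr_gt0// /a ge_min lexx orbT.
    by rewrite /= ger0_norm// subr_ge0 Phi_le1.
have [n0 n0P] : exists n0, forall n, (n0 <= n)%N ->
    [/\ (0 < n)%N, 1 <= n%:R * a ^+ 4 & K / (a ^+ 6 * Num.sqrt n%:R) <= e / 3].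
  have a40 : 0 < a ^+ 4 by rewrite exprn_gt0.
  have a60 : 0 < a ^+ 6 by rewrite exprn_gt0.
  pose B := Num.max (a ^- 4) ((K * 3 / (e * a ^+ 6)) ^+ 2).
  exists (Num.truncn B).+1 => n nB.
  have Bn : B <= n%:R.
    by apply: (le_trans (ltW (truncnS_gt B))); rewrite ler_nat.
  have n0 : (0 < n)%N by apply: leq_trans nB.
  split => //.
    rewrite -ler_pdivrMr// div1r; apply: le_trans Bn.
    by rewrite /B le_max lexx.
  have sn0 : 0 < Num.sqrt (n%:R : R) by rewrite sqrtr_gt0 ltr0n.
  have : K * 3 / (e * a ^+ 6) <= Num.sqrt n%:R.
    rewrite -[leLHS]ger0_norm; last first.
      by rewrite divr_ge0// mulr_ge0// ltW.
    rewrite -sqrtr_sqr ler_sqrt ?ler0n//.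
    by apply: le_trans Bn; rewrite /B le_max lexx orbT.
  rewrite ler_pdivrMr ?mulr_gt0// => h.
  by rewrite ler_pdivrMr ?mulr_gt0//; lra.
exists n0 => // n /= /n0P[n_gt0 na4 err].
have q0 : 0 < Num.sqrt (n%:R : R) by rewrite sqrtr_gt0 ltr0n.
set q := Num.sqrt _ in q0 err *.
have aq0 : 0 < a ^+ 2 * q by rewrite mulr_gt0// exprn_gt0.
have mle : measurable [set w | S n w <= c * q].
  by rewrite -[X in measurable X]setTI; exact: measurable_fun_le.
have mlt : measurable [set w | S n w < c * q].
  rewrite (_ : mkset _ = ~` [set w | c * q <= S n w]).
    by apply: measurableC; rewrite -[X in measurable X]setTI; exact: measurable_fun_le.
  by apply/seteqP; split=> w /=; rewrite ltNge => /negP.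
have LPhi b : L1 P (fun w => Phi ((b * q - S n w) / (a ^+ 2 * q))).
  by apply: L1_Phi; apply: measurable_funM => //; apply: measurable_funB.
have aE : a * q / (a ^+ 2 * q) = a^-1 by field; rewrite !gt_eqF.
split.
  have := smoothing (c + a) a0 na4; rewrite -/q ler_norml => /andP[_ h].
  have : pr P [set w | S n w <= c * q] * Phi a^-1 <=
      mean P (fun w => Phi (((c + a) * q - S n w) / (a ^+ 2 * q))).
    rewrite mulrC -(mean_indic P mle) -meanZ; last exact: L1_indic.
    apply: le_mean => //; first exact/L1Z/L1_indic.
    move=> w; rewrite indicE; case: (boolP (w \in _)) => [|_]; last by rewrite mulr0 Phi_ge0.
    rewrite inE /= mulr1 ler_Phi => Sc; rewrite -aE ler_pM2r ?invr_gt0//.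
    by rewrite mulrDl; lra.
  have : pr P [set w | S n w <= c * q] * (1 - Phi a^-1) <= 1 - Phi a^-1.
    by rewrite ler_piMl ?pr_le1// subr_ge0 Phi_le1.
  by rewrite mulrBr mulr1; lra.
have := smoothing (c - a) a0 na4; rewrite -/q ler_norml => /andP[h _].
have : mean P (fun w => Phi (((c - a) * q - S n w) / (a ^+ 2 * q))) <=
    pr P [set w | S n w < c * q] + Phi (- a^-1).
  rewrite -(mean_indic P mlt) -(mean_cst P (Phi (- a^-1))).
  rewrite -meanD; [|exact: L1_indic|exact: L1_cst].
  apply: le_mean => //; first by apply: L1D; [exact: L1_indic|exact: L1_cst].
  move=> w; rewrite indicE; case: (boolP (w \in _)) => [_|].
    by apply: (le_trans (Phi_le1 _)); rewrite lerDl Phi_ge0.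
  rewrite notin_setE /= => /negP; rewrite -leNgt => Sc.
  rewrite add0r ler_Phi -aE -mulNr ler_pM2r ?invr_gt0//.
  by rewrite mulrBl; lra.
have -> : Phi (- a^-1) = 1 - Phi a^-1 by exact: PhiN.
lra.
Qed.

End CentralLimit.

(** * Stopping windows *)

Section FirstTime.
Variable R : realType.
Implicit Types A : nat -> Prop.

(** The pattern of [sample_size] for an arbitrary predicate, convertible with it when the sample
    path is fixed. *)
Definition first_time A : \bar R :=
  ereal_inf [set (n%:R)%:E | n in [set n | (0 < n)%N /\ A n]].

Lemma first_time_le A n : (0 < n)%N -> A n -> (first_time A <= n%:R%:E)%E.
Proof. by move=> n0 An; apply: ereal_inf_lbound; exists n. Qed.

Lemma first_time_ge A (x : \bar R) :
  (forall n, (0 < n)%N -> A n -> (x <= n%:R%:E)%E) -> (x <= first_time A)%E.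
Proof. by move=> xA; apply: le_ereal_inf_tmp => _ [n [n0 An] <-]; exact: xA. Qed.

Lemma first_timeP A :
  (first_time A = +oo%E /\ forall n, (0 < n)%N -> ~ A n) \/
  exists n, [/\ (0 < n)%N, A n, first_time A = n%:R%:E &
                forall k, (0 < k < n)%N -> ~ A k].
Proof.
have [[n [n0 An]]|nA] := pselect (exists n, (0 < n)%N /\ A n); last first.
  left; split; last by move=> n n0 An; apply: nA; exists n.
  rewrite /first_time (_ : [set _ | n in _] = set0) ?ereal_inf0//.
  by rewrite -subset0 => t [n [n0 An] _]; apply: nA; exists n.
right.
have ex : exists n, (0 < n)%N && `[< A n >] by exists n; rewrite n0; apply/asboolP.
case: (ex_minnP ex) => k /andP[k0 /asboolP Ak] kmin; exists k; split => //.
  apply/eqP; rewrite eq_le first_time_le//=; apply: first_time_ge => j j0 Aj.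
  by rewrite lee_fin ler_nat; apply: kmin; rewrite j0; apply/asboolP.
move=> j /andP[j0 jk] Aj; have := kmin j; rewrite j0 leqNgt jk => /(_ _)/negP.
by apply => //; exact/asboolP.
Qed.

Lemma first_time_gt A n : (n%:R%:E < first_time A)%E <->
  (forall k, (0 < k <= n)%N -> ~ A k).
Proof.
split=> [nA k /andP[k0 kn] Ak|nA].
  have := lt_le_trans nA (first_time_le k0 Ak).
  by rewrite lte_fin ltr_nat ltnNge kn.
have [[-> _]|[k [k0 Ak -> kmin]]] := first_timeP A; first exact: ltry.
rewrite lte_fin ltr_nat ltnNge; apply/negP => kn.
by apply: (nA k) => //; rewrite k0.
Qed.

End FirstTime.

Section StoppingWindow.
Variable R : realType.
Variables (margin : R -> R -> R) (lam y v : nat -> R) (mu nu kap2 lam0 rho : R).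

(** The stopping condition along one fixed path: [y] and [v] stand for the sample mean and variance,
    [lam n] for the logarithm of the inverse of [delta_ n]. *)
Definition hit e n := v n + rho / n%:R <= n%:R / lam n * margin (y n) e.

Definition margin_asymp := forall eta, 0 < eta -> exists2 r, 0 < r &
  forall z e, `|z - mu| < r -> 0 < e < r ->
    kap2 * (1 - eta) * e ^+ 2 <= margin z e <= kap2 * (1 + eta) * e ^+ 2.

Hypothesis margin_mu : margin_asymp.
Hypothesis margin0 : forall z, margin z e @[e --> 0^'+] --> (0 : R).
Hypothesis lam_gt0 : forall n, (0 < n)%N -> 0 < lam n.
Hypothesis lam_lim : lam n @[n --> \oo] --> lam0.
Hypothesis y_lim : y n @[n --> \oo] --> mu.
Hypothesis v_lim : v n @[n --> \oo] --> nu.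
Hypothesis v_ge0 : forall n, 0 <= v n.
Hypotheses (kap2_gt0 : 0 < kap2) (lam0_gt0 : 0 < lam0) (nu_gt0 : 0 < nu) (rho_gt0 : 0 < rho).

Let M (e : R) := nu * lam0 / (kap2 * e ^+ 2).

Lemma near_size_ge B : \forall e \near 0^'+, B <= M e.
Proof.
pose b := Num.max B 1.
have b0 : 0 < b by rewrite lt_max ltr01 orbT.
have c0 : 0 < nu * lam0 / (kap2 * b) by rewrite divr_gt0// mulr_gt0.
near=> e.
have e0 : 0 < e by near: e; exact: nbhs_right_gt.
have e1 : e <= 1 by near: e; exact: nbhs_right_le.
have ec : e <= nu * lam0 / (kap2 * b) by near: e; exact: nbhs_right_le.
apply: (@le_trans _ _ b); first by rewrite le_max lexx.
rewrite /M ler_pdivlMr ?mulr_gt0 ?exprn_gt0//.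
move: ec; rewrite ler_pdivlMr ?mulr_gt0// => ec; apply: le_trans ec.
have -> : b * (kap2 * e ^+ 2) = e * (e * (kap2 * b)) by ring.
by rewrite ler_piMl// !mulr_ge0// ltW.
Unshelve. all: by end_near. Qed.

(** The left side of the condition is at least [rho / n%:R], whereas for each of finitely many [n]
    the right side tends to 0 with [e], wherever [y n] lies. *)
Lemma near_not_hit N : \forall e \near 0^'+, forall n, (0 < n < N)%N -> ~ hit e n.
Proof.
elim: N => [|N IH]; first by near=> e => n; rewrite ltn0 andbF.
have [->|N0] := posnP N; first by near=> e => n; case: n.
have h0 : N%:R / lam N * margin (y N) e @[e --> 0^'+] --> (0 : R).
  by rewrite -[X in _ --> X](mulr0 (N%:R / lam N)); apply: cvgM; [exact: cvg_cst|exact: margin0].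
have r0 : 0 < rho / N%:R by rewrite divr_gt0// ltr0n.
have h1 : \forall e \near 0^'+, ~ hit e N.
  move/cvgrPdist_lt : h0 => /(_ _ r0); apply: filterS => e.
  rewrite sub0r normrN => h; rewrite /hit => hh.
  have := le_lt_trans (ler_norm _) h; rewrite ltNge => /negP; apply.
  by apply: le_trans hh; rewrite lerDr.
near=> e => n; rewrite ltnS => /andP[n0].
rewrite leq_eqVlt => /predU1P[->|nN]; first by near: e.
by have : forall n, (0 < n < N)%N -> ~ hit e n; [near: e|apply; rewrite n0].
Unshelve. all: by end_near. Qed.

(** Beyond [N] each ingredient is within a relative [eta] of its limit, and [rho / n%:R] takes up
    half of the tolerance on [v n]. The condition is then nu lam0 <= n kap2 e^2 up to these factors,
    with [N] independent of [e]. *)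
Lemma hit_window eta : 0 < eta < 1 -> exists2 N, (0 < N)%N &
  \forall e \near 0^'+, forall n, (N <= n)%N ->
    (hit e n -> (1 - eta) ^+ 2 / (1 + eta) * M e <= n%:R) /\
    ((1 + eta) ^+ 2 / (1 - eta) * M e <= n%:R -> hit e n).
Proof.
move=> /andP[eta0 eta1].
have [r r0 rP] := margin_mu eta0.
have ne0 : 0 < nu * eta by rewrite mulr_gt0.
have le0 : 0 < lam0 * eta by rewrite mulr_gt0.
have ne20 : 0 < nu * eta / 2 by rewrite divr_gt0.
have [N1 _ N1P] : \forall n \near \oo, `|mu - y n| < r.
  by move/cvgrPdist_lt : y_lim => /(_ r r0).
have [N2 _ N2P] : \forall n \near \oo, `|nu - v n| < nu * eta / 2.
  by move/cvgrPdist_lt : v_lim => /(_ _ ne20).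
have [N3 _ N3P] : \forall n \near \oo, `|lam0 - lam n| < lam0 * eta.
  by move/cvgrPdist_lt : lam_lim => /(_ _ le0).
pose N4 := (Num.truncn (rho / (nu * eta / 2))).+1.
exists (maxn (maxn N1 N2) (maxn N3 N4)); first by rewrite !leq_max !orbT.
near=> e => n; rewrite !geq_max => /andP[/andP[n1 n2] /andP[n3 n4]].
have e0 : 0 < e by near: e; exact: nbhs_right_gt.
have er : e < r by near: e; exact: nbhs_right_lt.
have n0 : (0 < n)%N by apply: leq_trans n4.
have n0R : (0 : R) < n%:R by rewrite ltr0n.
have ln0 := lam_gt0 n0.
have := rP (y n) e; rewrite distrC => /(_ (N1P n n1)); rewrite e0 er => /(_ isT).
move=> /andP[m1 m2].
have := N2P n n2; rewrite /= ltr_norml => /andP[v1 v2].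
have := N3P n n3; rewrite /= ltr_norml => /andP[l1 l2].
have rn : rho / n%:R <= nu * eta / 2.
  rewrite ler_pdivrMr// mulrC -ler_pdivrMr//.
  by apply: (le_trans (ltW (truncnS_gt _))); rewrite ler_nat.
have rn0 : 0 < rho / n%:R by rewrite divr_gt0.
have e20 : 0 < e ^+ 2 by rewrite exprn_gt0.
have ME : M e * (kap2 * e ^+ 2) = nu * lam0.
  by rewrite /M divfK// gt_eqF// mulr_gt0.
split.
  rewrite /hit mulrAC ler_pdivlMr// => h.
  have h1 : nu * (1 - eta) * (lam0 * (1 - eta)) <= (v n + rho / n%:R) * lam n.
    by apply: ler_pM; rewrite ?mulr_ge0 ?ltW// ?subr_gt0//; lra.
  have h2 : n%:R * margin (y n) e <= n%:R * (kap2 * (1 + eta) * e ^+ 2).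
    by rewrite ler_wpM2l// ltW.
  have h3 := le_trans h1 (le_trans h h2).
  rewrite mulrAC ler_pdivrMr; last by lra.
  rewrite -(ler_pM2r (mulr_gt0 kap2_gt0 e20)).
  have -> : (1 - eta) ^+ 2 * M e * (kap2 * e ^+ 2) = nu * (1 - eta) * (lam0 * (1 - eta)).
    by rewrite -mulrA ME; ring.
  by apply: (le_trans h3); rewrite le_eqVlt; apply/orP; left; apply/eqP; ring.
move=> h; rewrite /hit mulrAC ler_pdivlMr//.
have h1 : (v n + rho / n%:R) * lam n <= nu * (1 + eta) * (lam0 * (1 + eta)).
  have := v_ge0 n => vn0.
  by apply: ler_pM; [rewrite addr_ge0// ltW|exact: ltW|lra|lra].
have h2 : n%:R * (kap2 * (1 - eta) * e ^+ 2) <= n%:R * margin (y n) e.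
  by rewrite ler_wpM2l// ltW.
apply: (le_trans h1); apply: le_trans h2.
move: h; rewrite mulrAC ler_pdivrMr; last by lra.
rewrite -(ler_pM2r (mulr_gt0 kap2_gt0 e20)).
have -> : (1 + eta) ^+ 2 * M e * (kap2 * e ^+ 2) = nu * (1 + eta) * (lam0 * (1 + eta)).
  by rewrite -mulrA ME; ring.
by move=> h; apply: (le_trans h); rewrite le_eqVlt; apply/orP; left; apply/eqP; ring.
Unshelve. all: by end_near. Qed.

Lemma first_time_window eta : 0 < eta -> \forall e \near 0^'+,
  (((1 - eta) * M e)%:E <= first_time R (hit e) <= ((1 + eta) * M e)%:E)%E.
Proof.
(* With this [h] the lower factor of [hit_window] is at least [1 - eta] and the upper one at most
   [1 + eta / 2]; the other half of [eta] absorbs rounding up to an integer. *)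
move=> eta0; pose h := Num.min (eta / 8) (5^-1).
have h0 : 0 < h by rewrite lt_min; apply/andP; split; lra.
have h5 : h <= 5^-1 by rewrite ge_min lexx orbT.
have h8 : h <= eta / 8 by rewrite ge_min lexx.
have h01 : 0 < h < 1 by apply/andP; split => //; lra.
have [N N0 NP] := hit_window h01.
have lo : 1 - eta <= (1 - h) ^+ 2 / (1 + h).
  rewrite ler_pdivlMr; last by lra.
  have : 0 <= eta * h by rewrite mulr_ge0 ?ltW.
  by have := sqr_ge0 h; rewrite (_ : (1 - h) ^+ 2 = 1 - 2 * h + h ^+ 2); [lra|ring].
have hi : (1 + h) ^+ 2 / (1 - h) <= 1 + eta / 2.
  rewrite ler_pdivrMr; last by lra.
  have : (5^-1 - h) * eta >= 0 by rewrite mulr_ge0//; lra.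
  have : (5^-1 - h) * h >= 0 by rewrite mulr_ge0//; lra.
  rewrite (_ : (1 + h) ^+ 2 = 1 + 2 * h + h ^+ 2); last by ring.
  by rewrite !expr2; lra.
near=> e.
have M0 : 1 <= M e by near: e; exact: near_size_ge.
have MN : N%:R <= M e by near: e; exact: near_size_ge.
have Meta : 2 / eta <= M e by near: e; exact: near_size_ge.
have nohit : forall n, (0 < n < N)%N -> ~ hit e n by near: e; exact: near_not_hit.
have W : forall n, (N <= n)%N ->
    (hit e n -> (1 - h) ^+ 2 / (1 + h) * M e <= n%:R) /\
    ((1 + h) ^+ 2 / (1 - h) * M e <= n%:R -> hit e n) by near: e.
have Me0 : 0 <= M e by lra.
apply/andP; split.
  apply: first_time_ge => n n0 hn; rewrite lee_fin.
  have [nN|Nn] := ltnP n N; first by case: (nohit n) => //; rewrite n0.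
  by apply: le_trans ((W n Nn).1 hn); rewrite ler_wpM2r.
pose n := (Num.truncn ((1 + eta / 2) * M e)).+1.
have ni : (1 + eta / 2) * M e < n%:R by exact: truncnS_gt.
have nle : n%:R <= (1 + eta / 2) * M e + 1.
  by rewrite /n -natr1 lerD2r truncn_le mulr_ge0//; lra.
have Nn : (N <= n)%N.
  rewrite -(ler_nat R); apply: (le_trans MN); apply: le_trans (ltW ni).
  by rewrite ler_peMl//; lra.
have hn : hit e n.
  by apply: (W n Nn).2; apply: le_trans (ltW ni); rewrite ler_wpM2r.
apply: (le_trans (first_time_le _ _ hn)) => //; rewrite lee_fin.
apply: (le_trans nle); move: Meta; rewrite ler_pdivrMr// => Meta; lra.
Unshelve. all: by end_near. Qed.

Lemma first_time_ratio : (first_time R (hit e) / (M e)%:E)%E @[e --> 0^'+] --> 1%E.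
Proof.
apply/fine_cvgP; split.
  near=> e.
  have : (((1 - 1) * M e)%:E <= first_time R (hit e) <= ((1 + 1) * M e)%:E)%E.
    by near: e; exact: first_time_window.
  have M0 : 1 <= M e by near: e; exact: near_size_ge.
  have Mn0 : M e != 0 by rewrite gt_eqF//; lra.
  case: (first_time _ _) => [r _|/andP[_]|/andP[]]; rewrite ?leye_eq ?leeNy_eq//.
  by rewrite inver (negbTE Mn0) -EFinM.
apply/cvgrPdist_le => eta eta0; near=> e => /=.
have : (((1 - eta) * M e)%:E <= first_time R (hit e) <= ((1 + eta) * M e)%:E)%E.
  by near: e; exact: first_time_window.
have M0 : 1 <= M e by near: e; exact: near_size_ge.
have Mn0 : M e != 0 by rewrite gt_eqF//; lra.
case: (first_time _ _) => [r|/andP[_]|/andP[]]; rewrite ?leye_eq ?leeNy_eq//.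
rewrite !lee_fin => /andP[h1 h2].
rewrite inver (negbTE Mn0) -EFinM /=.
have M1 : 0 < M e by lra.
rewrite ler_norml; apply/andP; split.
  by rewrite lerBrDr addrC -lerBrDr ler_pdivrMr// opprK.
by rewrite lerBlDr addrC -lerBlDr ler_pdivlMr.
Unshelve. all: by end_near. Qed.

End StoppingWindow.

(** * Margins of the limit functions and convergence to the normal quantile *)

Section Margins.
Variable R : realType.
Implicit Types (L U : R -> R -> R) (z e mu : R).

Definition margin L U z e := Num.min (`|U z e - z| ^+ 2) (`|L z e - z| ^+ 2).

Lemma margin_bounds L U z e lo hi : 0 <= lo ->
  lo <= `|U z e - z| <= hi -> lo <= `|L z e - z| <= hi ->
  lo ^+ 2 <= margin L U z e <= hi ^+ 2.
Proof.
move=> lo0 /andP[u1 u2] /andP[l1 l2].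
rewrite /margin le_min ge_min; apply/andP; split.
  by rewrite !lerXn2r// nnegrE.
by rewrite lerXn2r// nnegrE// (le_trans _ u2).
Qed.

Lemma margins_equivP Theta kappa L U mu eta : margins_equiv Theta kappa L U ->
  Theta mu -> 0 < eta -> exists2 r, 0 < r & forall z e, `|z - mu| < r -> 0 < e < r ->
    `|z - L z e - kappa mu * e| <= eta * e /\ `|U z e - z - kappa mu * e| <= eta * e.
Proof.
move=> LU Tmu eta0; have [hL hU] := LU mu Tmu.
have near_mu (f : R -> R -> R) : f x.1 x.2 / x.2 @[x --> (nbhs mu, 0^'+)] --> kappa mu ->
    exists2 r, 0 < r & forall z e, `|z - mu| < r -> 0 < e < r ->
      `|f z e - kappa mu * e| <= eta * e.
  move=> /cvgrPdist_le/(_ _ eta0)[[A B]/= [/nbhs_ballP[r1 r10 Ar] [r2 /= r20 Br]] AB].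
  exists (Num.min r1 r2); first by rewrite lt_min r10.
  move=> z e; rewrite !lt_min => /andP[zr1 _] /andP[e0 /andP[_ er2]].
  have := AB (z, e); rewrite /= => /(_ _)/wrap[].
    split; first by apply: Ar; rewrite /ball /= distrC.
    by apply: Br => //=; rewrite sub0r normrN gtr0_norm.
  rewrite distrC => h; rewrite -(ler_pM2r e0) in h.
  have -> : f z e - kappa mu * e = (f z e / e - kappa mu) * e by field; rewrite gt_eqF.
  by rewrite normrM (gtr0_norm e0).
have [r1 r10 h1] := near_mu (fun z e => z - L z e) hL.
have [r2 r20 h2] := near_mu (fun z e => U z e - z) hU.
exists (Num.min r1 r2); first by rewrite lt_min r10.
move=> z e; rewrite !lt_min => /andP[z1 z2] /andP[e0 /andP[e1 e2]].
by split; [apply: h1|apply: h2]; rewrite // e0.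
Qed.

Lemma margins_equiv_asymp Theta kappa L U mu : margins_equiv Theta kappa L U ->
  Theta mu -> 0 < kappa mu -> margin_asymp (margin L U) mu (kappa mu ^+ 2).
Proof.
(* Since t^2 <= t, the squares of 1 - t and 1 + t stay within 3 t, hence within [eta], of 1. *)
move=> LU Tmu k0 eta eta0; pose t := Num.min eta 1 / 3.
have min1 : Num.min eta 1 <= 1 by rewrite ge_min lexx orbT.
have mine : Num.min eta 1 <= eta by rewrite ge_min lexx.
have t1 : 3 * t <= 1 by rewrite /t; lra.
have te : 3 * t <= eta by rewrite /t; lra.
have t0 : 0 < t by rewrite divr_gt0// lt_min eta0 ltr01.
have kt0 : 0 < kappa mu * t by rewrite mulr_gt0.
have [r r0 rP] := margins_equivP LU Tmu kt0.
exists r => // z e zr er; have [hL hU] := rP z e zr er.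
have /andP[e0 _] := er.
have te0 : 0 < kappa mu * e by rewrite mulr_gt0.
have b (x : R) : `|x - kappa mu * e| <= kappa mu * t * e ->
    (kappa mu * e) * (1 - t) <= `|x| <= (kappa mu * e) * (1 + t).
  rewrite ler_norml => /andP[x1 x2].
  have h : 0 <= (kappa mu * e) * (1 - t) by rewrite mulr_ge0 ?(ltW te0)//; lra.
  have x0 : 0 <= x by lra.
  by rewrite ger0_norm//; apply/andP; split; lra.
have bU := b _ hU; have := b _ hL; rewrite distrC => bL.
have lo0 : 0 <= (kappa mu * e) * (1 - t) by rewrite mulr_ge0 ?(ltW te0)//; lra.
have /andP[m1 m2] := margin_bounds lo0 bU bL.
have t20 := sqr_ge0 t.
have tt : t ^+ 2 <= t by rewrite expr2 ler_piMr ?ltW//; lra.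
have k2e2 : 0 <= (kappa mu * e) ^+ 2 by rewrite sqr_ge0.
apply/andP; split.
  apply: le_trans m1.
  rewrite [leRHS]exprMn (_ : _ * e ^+ 2 = (kappa mu * e) ^+ 2 * (1 - eta)) ?ler_wpM2l//; last by ring.
  by rewrite (_ : (1 - t) ^+ 2 = 1 - 2 * t + t ^+ 2); [lra|ring].
apply: (le_trans m2).
rewrite [leLHS]exprMn (_ : _ * e ^+ 2 = (kappa mu * e) ^+ 2 * (1 + eta)) ?ler_wpM2l//; last by ring.
by rewrite (_ : (1 + t) ^+ 2 = 1 + 2 * t + t ^+ 2); [lra|ring].
Qed.

Lemma margin_vanish Theta kappa L U z : margins_equiv Theta kappa L U ->
  margins_vanish_off Theta L U -> (forall mu, Theta mu -> 0 < kappa mu) ->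
  margin L U z e @[e --> 0^'+] --> (0 : R).
Proof.
move=> LU LUoff k0; have [Tz|nTz] := pselect (Theta z); last exact: LUoff.
have [r r0 rP] := margins_equiv_asymp LU Tz (k0 z Tz) ltr01.
apply/cvgrPdist_le => eta eta0.
have c0 : 0 < kappa z ^+ 2 * (1 + 1) by rewrite mulr_gt0 ?exprn_gt0 ?k0.
near=> e; rewrite sub0r normrN.
have e0 : 0 < e by near: e; exact: nbhs_right_gt.
have er : e < r by near: e; exact: nbhs_right_lt.
have e1 : e <= 1 by near: e; exact: nbhs_right_le.
have ee : e <= eta / (kappa z ^+ 2 * (1 + 1)).
  by near: e; apply: nbhs_right_le; rewrite divr_gt0.
have := rP z e; rewrite subrr normr0 r0 e0 er => /(_ isT isT)/andP[_ m2].
have m0 : 0 <= margin L U z e by rewrite le_min !sqr_ge0.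
rewrite ger0_norm//; apply: (le_trans m2).
apply: (@le_trans _ _ (kappa z ^+ 2 * (1 + 1) * e)).
  by rewrite ler_wpM2l ?(ltW c0)// expr2 ler_piMl// ltW.
by rewrite mulrC -ler_pdivlMr.
Unshelve. all: by end_near. Qed.

Lemma slice_continuous (f : R -> R -> R) e : 0 < e ->
  {within [set x : R * R | 0 < x.2], continuous (fun x : R * R => f x.1 x.2)} ->
  continuous (f^~ e).
Proof.
move=> e0 cf z.
have op : open [set x : R * R | 0 < x.2].
  have -> : [set x : R * R | 0 < x.2] = snd @^-1` [set y : R | 0 < y] by [].
  by apply: open_comp; [move=> x _; exact: cvg_snd|exact: open_gt].
rewrite continuous_open_subspace// in cf.
have := cf (z, e); rewrite inE /= => /(_ e0) h.
apply: (@continuous_comp _ _ _ (fun z : R => (z, e)) (fun x => f x.1 x.2)) => //.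
apply: (@cvg_pair _ _ _ (nbhs z) (nbhs z) (nbhs e) _ _ _ (fun z => z) (fun=> e)).
  exact: cvg_id.
exact: cvg_cst.
Qed.

Lemma margin_continuous L U e : continuous (L^~ e) -> continuous (U^~ e) ->
  continuous (fun z => margin L U z e).
Proof.
move=> cL cU z; have c (f : R -> R -> R) : continuous (f^~ e) ->
    {for z, continuous (fun z => `|f z e - z| ^+ 2)}.
  move=> cf; apply: (@continuous_comp _ _ _ (fun z => `|f z e - z|) (fun x => x ^+ 2)).
    by apply: cvg_norm; apply: cvgB; [exact: cf|exact: cvg_id].
  exact: exprn_continuous.
exact: (continuous_min (c U cU) (c L cL)).
Qed.

Lemma margin_gt0 L U z e : L z e < z < U z e -> 0 < margin L U z e.
Proof.
move=> /andP[h1 h2]; rewrite lt_min !exprn_gt0// normr_gt0 subr_eq0.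
  by rewrite lt_eqF.
by rewrite gt_eqF.
Qed.

Lemma quantile_gt0 delta : 0 < delta < 1 -> 0 < stdnormal_quantile (1 - delta / 2 : R).
Proof.
move=> /andP[d0 d1]; rewrite -ltr_Phi Phi0 Phi_quantile; first by lra.
by apply/andP; split; lra.
Qed.

(** As [stdnormal_cdf] is strictly increasing, closeness of its values to [p] confines
    [Num.sqrt (u n)] to a neighbourhood of the quantile. *)
Lemma cvg_quantile_sqr (u : nat -> R) (p : R) : 0 < p < 1 -> (forall n, (0 < n)%N -> 0 < u n) ->
  stdnormal_cdf (Num.sqrt (u n)) @[n --> \oo] --> p ->
  u n @[n --> \oo] --> stdnormal_quantile p ^+ 2.
Proof.
move=> p01 u0; rewrite -{1}(Phi_quantile p01); set Z := stdnormal_quantile p => uZ.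
have sZ : Num.sqrt (u n) @[n --> \oo] --> Z.
  apply/cvgrPdist_lt => e e0.
  have h1 : 0 < stdnormal_cdf (Z + e) - stdnormal_cdf Z.
    by rewrite subr_gt0 ltr_Phi ltrDl.
  have h2 : 0 < stdnormal_cdf Z - stdnormal_cdf (Z - e).
    by rewrite subr_gt0 ltr_Phi ltrBlDr ltrDl.
  move/cvgrPdist_lt : uZ => uZ; near=> n.
  have : `|stdnormal_cdf Z - stdnormal_cdf (Num.sqrt (u n))| <
      stdnormal_cdf (Z + e) - stdnormal_cdf Z by near: n; exact: uZ.
  have : `|stdnormal_cdf Z - stdnormal_cdf (Num.sqrt (u n))| <
      stdnormal_cdf Z - stdnormal_cdf (Z - e) by near: n; exact: uZ.
  rewrite !ltr_distlC subKr ltr_Phi => /andP[-> _].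
  by rewrite [_ + (stdnormal_cdf (Z + e) - _)]addrC subrK ltr_Phi => /andP[_ ->].
have : Num.sqrt (u n) ^+ 2 @[n --> \oo] --> Z ^+ 2.
  by under eq_fun do rewrite expr2; rewrite expr2; exact: cvgM.
apply: cvg_trans; apply: near_eq_cvg; near=> n.
by rewrite sqr_sqrtr// ltW// u0//; near: n; exact: nbhs_infty_gt.
Unshelve. all: by end_near. Qed.

End Margins.

(** * Sample mean and variance in terms of centred sums *)

Section SampleStatistics.
Variables (T : Type) (R : realType).

Lemma sample_mean_center (Xs : nat -> T -> R) mu n w : (0 < n)%N ->
  sample_mean Xs n w = mu + (\sum_(0 <= i < n) (Xs i w - mu)) / n%:R.
Proof.
move=> n0; rewrite /sample_mean big_mkord sumrB sumr_const card_ord mulrBl.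
by rewrite -[mu *+ n]mulr_natr mulfK ?pnatr_eq0 -?lt0n// mulrC; ring.
Qed.

(** Centring at [mu] instead of the sample mean leaves an average of terms that no longer depend on
    one another's values, minus a square; in upper bounds the square is simply dropped. *)
Lemma sample_var_center (Xs : nat -> T -> R) mu nu n w : (0 < n)%N ->
  sample_var Xs n w = nu + (\sum_(0 <= i < n) ((Xs i w - mu) ^+ 2 - nu)) / n%:R
    - ((\sum_(0 <= i < n) (Xs i w - mu)) / n%:R) ^+ 2.
Proof.
move=> n0; have n0R : (n%:R : R) != 0 by rewrite pnatr_eq0 -lt0n.
rewrite /sample_var (sample_mean_center Xs mu w n0).
set S := \sum_(0 <= i < n) (Xs i w - mu).
have -> : \sum_(i < n) (Xs i w - (mu + S / n%:R)) ^+ 2 =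
    \sum_(i < n) ((Xs i w - mu) ^+ 2 - 2 * (S / n%:R) * (Xs i w - mu) + (S / n%:R) ^+ 2).
  by apply: eq_bigr => i _; ring.
have SE : \sum_(i < n) (Xs i w - mu) = S by rewrite /S big_mkord.
have QE : \sum_(0 <= i < n) ((Xs i w - mu) ^+ 2 - nu) =
    \sum_(i < n) (Xs i w - mu) ^+ 2 - nu *+ n.
  by rewrite big_mkord sumrB sumr_const card_ord.
rewrite QE big_split/= [\sum_(i < n) (_ - _ * (Xs i w - mu))]sumrB -mulr_sumr SE sumr_const card_ord.
rewrite -[nu *+ n]mulr_natr -[(S / _) ^+ 2 *+ n]mulr_natr; field.
exact: n0R.
Qed.

End SampleStatistics.

(** * The sampling procedure *)

(** A right limit can be tested on sequences, and along a sequence continuity from above applies. *)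
Lemma ae_near_pr0 d (T : measurableType d) (R : realType) (P : probability T R)
    (B : R -> set T) : (forall e, 0 < e -> measurable (B e)) ->
  {ae P, forall w, \forall e \near 0^'+, ~ B e w} ->
  pr P (B e) @[e --> 0^'+] --> (0 : R).
Proof.
move=> mB aeB; apply/cvg_at_rightP => u [u0 ul].
apply: ae_eventually_not_pr0; first by move=> n; exact: mB.
apply: filterS aeB => w [r /= r0 rB].
move/cvgrPdist_lt : ul => /(_ r r0); apply: filterS => n h; apply: rB => //.
Qed.

(** * Moments, limits and tail bounds of the sample statistics *)

Section SampleMoments.
Context d (T : measurableType d) (R : realType) (P : probability T R).
Variables (X : {RV P >-> R}) (Xs : nat -> {RV P >-> R}) (mu nu : R).
Hypothesis X_iid : iid_samples X Xs.
Hypothesis X_mean : ('E_P[X] = mu%:E)%E.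
Hypothesis X_var : ('V_P[X] = nu%:E)%E.
Hypothesis nu_gt0 : 0 < nu.
Hypothesis X_moment : ('E_P[fun w => (`|X w| ^+ 6)%R] < +oo)%E.

Definition dev (x : R) : R := x - mu.
Definition sqdev (x : R) : R := (x - mu) ^+ 2 - nu.

Lemma measurable_dev : measurable_fun [set: R] dev.
Proof. by apply: measurable_funB. Qed.

Lemma measurable_sqdev : measurable_fun [set: R] sqdev.
Proof. by apply: measurable_funB => //; apply: measurable_funX; exact: measurable_dev. Qed.

Let L6 : L1 P (fun w => `|X w| ^+ 6).
Proof.
apply/integrableP; split.
  by apply/measurable_EFinP/measurable_funX; exact: measurableT_comp.
move: X_moment; rewrite unlock; congr (_ < _)%E; apply: eq_integral => w _ /=.
by rewrite (@ger0_norm _ (`|X w| ^+ 6)) ?exprn_ge0.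
Qed.

Let Ldev6 : L1 P (fun w => `|dev (X w)| ^+ 6).
Proof.
(* The factor 64 is 2^6: |x - mu| is at most twice the larger of |x| and |mu|. *)
apply: (L1_le (g := fun w => 64 * (`|X w| ^+ 6 + `|mu| ^+ 6))).
- apply: measurable_funX; apply: measurableT_comp => //.
  by apply: measurableT_comp => //; exact: measurable_dev.
- move=> w; rewrite (@ger0_norm _ (_ ^+ 6)) ?exprn_ge0// /dev.
  apply: (@le_trans _ _ ((2 * Num.max `|X w| `|mu|) ^+ 6)).
    rewrite lerXn2r ?nnegrE// ?mulr_ge0// ?le_max ?normr_ge0//.
    apply: (le_trans (ler_normB _ _)).
    have h1 : `|X w| <= Num.max `|X w| `|mu| by rewrite le_max lexx.
    have h2 : `|mu| <= Num.max `|X w| `|mu| by rewrite le_max lexx orbT.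
    lra.
  rewrite exprMn (_ : (2 : R) ^+ 6 = 64); last by ring.
  rewrite ler_wpM2l//; case: (leP `|X w| `|mu|) => _.
    by rewrite lerDr exprn_ge0.
  by rewrite lerDl exprn_ge0.
- by apply: L1Z; apply: L1D => //; exact: L1_cst.
Qed.

Lemma L1_dev k : (k <= 6)%N -> L1 P (fun w => dev (X w) ^+ k).
Proof.
move=> k6; apply: (L1_pow _ k6) => //.
by apply: measurableT_comp => //; exact: measurable_dev.
Qed.

Lemma L1_norm_dev3 : L1 P (fun w => `|dev (X w)| ^+ 3).
Proof.
have := L1_norm (L1_dev (isT : (3 <= 6)%N)).
by under eq_fun do rewrite normrX.
Qed.

Lemma mean_dev : mean P (dev \o X) = 0.
Proof.
have LX : L1 P X.
  by apply: (@L1_pow _ _ _ _ X 1 6).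
have EX : mean P X = mu.
  by apply: EFin_inj; rewrite -EFin_mean// -X_mean unlock.
rewrite (_ : dev \o X = fun w => X w - mu)// meanB ?mean_cst ?EX ?subrr//.
exact: L1_cst.
Qed.

Lemma mean_dev2 : mean P (fun w => dev (X w) ^+ 2) = nu.
Proof.
apply: EFin_inj; rewrite -EFin_mean ?L1_dev// -X_var /variance unlock X_mean unlock.
by apply: eq_integral => w _; rewrite /dev/= !fctE/= expr2.
Qed.

Lemma L1_sqdev2 : L1 P (fun w => sqdev (X w) ^+ 2).
Proof.
have -> : (fun w => sqdev (X w) ^+ 2) =
    (fun w => dev (X w) ^+ 4 + (- 2 * nu) * dev (X w) ^+ 2 + nu ^+ 2).
  by apply/funext => w; rewrite /sqdev /dev; ring.
apply: L1D; last exact: L1_cst.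
by apply: L1D; [exact: L1_dev|apply: L1Z; exact: L1_dev].
Qed.

Lemma L1_sqdev : L1 P (sqdev \o X).
Proof. by apply: L1B; [exact: (@L1_dev 2)|exact: L1_cst]. Qed.

Lemma mean_sqdev : mean P (sqdev \o X) = 0.
Proof.
rewrite (_ : sqdev \o X = fun w => dev (X w) ^+ 2 - nu)//.
by rewrite meanB ?mean_cst ?mean_dev2 ?subrr//; [exact: L1_dev|exact: L1_cst].
Qed.

Lemma sample_mean_psum n w : (0 < n)%N ->
  sample_mean (Xs : nat -> T -> R) n w = mu + psum Xs dev 0 n w / n%:R.
Proof. exact: sample_mean_center. Qed.

Lemma sample_var_psum n w : (0 < n)%N ->
  sample_var (Xs : nat -> T -> R) n w =
  nu + psum Xs sqdev 0 n w / n%:R - (psum Xs dev 0 n w / n%:R) ^+ 2.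
Proof. exact: sample_var_center. Qed.

Lemma sample_var_ge0 n w : 0 <= sample_var (Xs : nat -> T -> R) n w.
Proof.
by rewrite mulr_ge0 ?invr_ge0// sumr_ge0// => i _; exact: sqr_ge0.
Qed.

Lemma measurable_sample_mean n :
  measurable_fun [set: T] (sample_mean (Xs : nat -> T -> R) n).
Proof.
by apply: measurable_funM => //; apply: measurable_sum => i.
Qed.

Lemma measurable_sample_var n :
  measurable_fun [set: T] (sample_var (Xs : nat -> T -> R) n).
Proof.
apply: measurable_funM => //; apply: measurable_sum => i.
by apply: measurable_funX; apply: measurable_funB => //; exact: measurable_sample_mean.
Qed.

Lemma sample_limits : {ae P, forall w,
  (sample_mean (Xs : nat -> T -> R) n w @[n --> \oo] --> mu) /\
  (sample_var (Xs : nat -> T -> R) n w @[n --> \oo] --> nu)}.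
Proof.
have h1 := strong_law X_iid measurable_dev (@L1_dev 1 isT) (@L1_dev 2 isT) mean_dev.
have h2 := strong_law X_iid measurable_sqdev L1_sqdev L1_sqdev2 mean_sqdev.
apply: filterS2 h1 h2 => w y0 q0.
(* The centred formulas hold for [0 < n] only, so limits are carried over along eventual
   equality. *)
have shift (a l : R) (u v : nat -> R) : v n @[n --> \oo] --> l ->
    (forall n, (0 < n)%N -> u n = v n) -> u n @[n --> \oo] --> l.
  move=> vl uv; apply: cvg_trans vl; apply: near_eq_cvg; near=> n.
  by rewrite uv//; near: n; exact: nbhs_infty_gt.
split.
  apply: (shift 0 _ _ (fun n => mu + psum Xs dev 0 n w / n%:R)); last first.
    by move=> n n0; exact: sample_mean_psum.
  by rewrite -[X in _ --> X]addr0; apply: cvgD => //; exact: cvg_cst.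
apply: (shift 0 _ _ (fun n => nu + psum Xs sqdev 0 n w / n%:R - (psum Xs dev 0 n w / n%:R) ^+ 2)).
  rewrite -[X in _ --> X]subr0 -[X in _ --> X - _]addr0 -[X in _ --> _ - X](mul0r 0).
  apply: cvgB; first by apply: cvgD => //; exact: cvg_cst.
  by under eq_fun do rewrite expr2; exact: cvgM.
by move=> n n0; exact: sample_var_psum.
Unshelve. all: by end_near. Qed.

Lemma sample_mean_tail r : 0 < r -> exists2 C, 0 <= C & forall n, (0 < n)%N ->
  pr P [set w | r <= `|sample_mean (Xs : nat -> T -> R) n w - mu|] <= C / n%:R ^+ 2.
Proof.
move=> r0.
pose m4 := mean P (fun w => dev (X w) ^+ 4).
have m40 : 0 <= m4 by apply: mean_ge0 => w; exact: exprn_even_ge0.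
exists ((m4 + 3 * nu ^+ 2) / r ^+ 4) => [|n n0].
  by rewrite divr_ge0 ?exprn_ge0 ?(ltW r0)// addr_ge0// mulr_ge0 ?sqr_ge0.
have n0R : (0 : R) < n%:R by rewrite ltr0n.
have := psum_fourth_moment_tail X_iid measurable_dev (@L1_dev 4 isT) mean_dev n
  (mulr_gt0 r0 n0R).
rewrite mean_dev2 -/m4.
rewrite (_ : mkset _ = [set w | r <= `|sample_mean (Xs : nat -> T -> R) n w - mu|]).
  move=> h; apply: (le_trans h); rewrite le_eqVlt; apply/orP; left; apply/eqP.
  by field; rewrite !gt_eqF.
apply/seteqP; split=> w /=; rewrite sample_mean_psum// addrAC subrr add0r.
  by rewrite normrM normfV (gtr0_norm n0R) ler_pdivlMr.
by rewrite normrM normfV (gtr0_norm n0R) ler_pdivlMr.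
Qed.

(** The level [a] is left free: it will be of order n^2, for which Chebyshev is already summable. *)
Lemma sqdev_tail : exists2 C, 0 <= C & forall a n, 0 < a ->
  pr P [set w | a <= `|psum Xs sqdev 0 n w|] <= n%:R * C / a ^+ 2.
Proof.
exists (mean P (fun w => sqdev (X w) ^+ 2)).
  by apply: mean_ge0 => w; exact: sqr_ge0.
move=> a n a0.
exact: (chebyshev_psum X_iid measurable_sqdev L1_sqdev L1_sqdev2 mean_sqdev n a0).
Qed.

Lemma dev_maximal a m k : 0 < a ->
  pr P (max_exceeds Xs dev a m k) <= k%:R * nu / a ^+ 2.
Proof.
move=> a0; rewrite -mean_dev2.
exact: (maximal_inequality X_iid measurable_dev (@L1_dev 1 isT) (@L1_dev 2 isT) mean_dev m k a0).
Qed.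

Lemma dev_central_limit (c e : R) : 0 < e ->
  \forall n \near \oo,
    pr P [set w | psum Xs dev 0 n w <= c * Num.sqrt (nu * n%:R)] <= stdnormal_cdf c + e /\
    stdnormal_cdf c - e <= pr P [set w | psum Xs dev 0 n w < c * Num.sqrt (nu * n%:R)].
Proof.
move=> e0; pose s := Num.sqrt nu.
have s0 : 0 < s by rewrite sqrtr_gt0.
pose g x := s^-1 * dev x.
have mg : measurable_fun [set: R] g by apply: measurable_funM => //; exact: measurable_dev.
have g3 : L1 P (fun w => `|g (X w)| ^+ 3).
  under eq_fun do rewrite normrM exprMn; apply: L1Z; exact: L1_norm_dev3.
have gm : mean P (g \o X) = 0.
  by rewrite (_ : g \o X = fun w => s^-1 * dev (X w))// meanZ ?mean_dev ?mulr0//; exact: (@L1_dev 1).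
have gv : mean P (fun w => g (X w) ^+ 2) = 1.
  under [X in mean _ X]eq_fun do rewrite exprMn; rewrite meanZ ?mean_dev2 ?L1_dev//.
  by rewrite exprVn sqr_sqrtr ?(ltW nu_gt0)// mulVf ?gt_eqF.
have pE n w : psum Xs g 0 n w = s^-1 * psum Xs dev 0 n w by rewrite /psum mulr_sumr.
have := central_limit X_iid mg g3 gm gv c e0; apply: filterS => n.
have qE : Num.sqrt (nu * n%:R) = s * Num.sqrt n%:R by rewrite sqrtrM// ltW.
rewrite qE; under eq_set do rewrite pE ler_pdivrMl// mulrCA.
by under [X in _ <= pr P X]eq_set do rewrite pE ltr_pdivrMl// mulrCA.
Qed.

End SampleMoments.

(** An integer is the number of naturals below it; the identity also covers a time that is infinite,
    where all indicators are 1. *)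
Lemma first_time_sum (R : realType) (A : nat -> Prop) :
  first_time R A =
  (\sum_(n <oo) (\1_[set n | (n%:R%:E < first_time R A)%E] n)%:E)%E.
Proof.
have ind1 n : (n%:R%:E < first_time R A)%E ->
    (\1_[set n | (n%:R%:E < first_time R A)%E] n)%:E = 1%E :> \bar R.
  by move=> h; rewrite indicE mem_set.
have ind0 n : ~ (n%:R%:E < first_time R A)%E ->
    (\1_[set n | (n%:R%:E < first_time R A)%E] n)%:E = 0%E :> \bar R.
  by move=> h; rewrite indicE memNset.
have nneg n : (0 <= (\1_[set n | (n%:R%:E < first_time R A)%E] n)%:E :> \bar R)%E.
  by rewrite lee_fin.
have pre k : (forall n, (n < k)%N -> (n%:R%:E < first_time R A)%E) ->
    (\sum_(0 <= n < k) (\1_[set n | (n%:R%:E < first_time R A)%E] n)%:E = k%:R%:E :> \bar R)%E.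
  move=> h; rewrite big_nat_cond (eq_bigr (fun=> 1%E)); last first.
    by move=> n /andP[/andP[_ nk] _]; apply: ind1; exact: h.
  by rewrite -big_nat_cond sumEFin big_const_nat subn0 iter_addr_0.
have [[Aoo _]|[k [k0 Ak Ek _]]] := first_timeP R A.
  rewrite [LHS]Aoo; apply/esym/eq_infty => r.
  apply: (@le_trans _ _ (Num.truncn r).+1%:R%:E).
    by rewrite lee_fin; exact/ltW/truncnS_gt.
  rewrite -pre; last by move=> n _; rewrite Aoo ltry.
  exact: nneseries_lim_ge.
rewrite (nneseries_split 0 k)// add0n pre; last first.
  by move=> n nk; rewrite Ek lte_fin ltr_nat.
rewrite eseries0 ?adde0// => n kn _; apply: ind0.
by rewrite Ek lte_fin ltr_nat; apply/negP; rewrite -leqNgt.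
Qed.

(** * The sample size as a random variable *)

Section SampleSize.
Context d (T : measurableType d) (R : realType) (P : probability T R).
Variables (L U : R -> R -> R) (delta_ : nat -> R) (rho : R) (Xs : nat -> {RV P >-> R}).
Variable e : R.
Hypothesis L_cont : continuous (L^~ e).
Hypothesis U_cont : continuous (U^~ e).

Let nn := sample_size L U delta_ rho (Xs : nat -> T -> R) e.
Let stop n := [set w | stop_cond L U delta_ rho (Xs : nat -> T -> R) e n w].

Definition running n := [set w | (n%:R%:E < nn w)%E].

Lemma sample_size_first_time w : nn w = first_time R (fun n => stop n w).
Proof. by []. Qed.

Lemma measurable_stop n : measurable (stop n).
Proof.
rewrite -[X in measurable X]setTI; apply: measurable_fun_le => //.
  by apply: measurable_funD => //; exact: measurable_sample_var.
apply: measurable_funM => //.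
apply: (measurableT_comp (f := fun z => margin L U z e)).
  by apply: continuous_measurable_fun; exact: margin_continuous.
exact: measurable_sample_mean.
Qed.

Lemma running_sub_notstop n : (0 < n)%N -> running n `<=` ~` stop n.
Proof. by move=> n0 w /first_time_gt h; apply: h; rewrite n0 leqnn. Qed.

Lemma measurable_running n : measurable (running n).
Proof.
have -> : running n = \bigcap_(k in [set k | (0 < k <= n)%N]) ~` stop k.
  apply/seteqP; split=> w /=; first by move=> /first_time_gt h k /h.
  by move=> h; apply/first_time_gt => k /h.
by apply: bigcap_measurableType => k _; exact/measurableC/measurable_stop.
Qed.

Lemma sample_size_sum w : nn w = (\sum_(n <oo) (\1_(running n) w)%:E)%E.
Proof. by rewrite sample_size_first_time first_time_sum. Qed.

Lemma measurable_sample_size : measurable_fun [set: T] nn.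
Proof.
rewrite (_ : nn = fun w => (\sum_(n <oo) (\1_(running n) w)%:E)%E); last first.
  by apply/funext => w; exact: sample_size_sum.
apply: ge0_emeasurable_sum => [n w _ _|n _]; first by rewrite lee_fin.
exact/measurable_EFinP/measurable_indic/measurable_running.
Qed.

Lemma sample_size_ge0 w : (0 <= nn w)%E.
Proof. by apply: first_time_ge => n _ _; rewrite lee_fin. Qed.

Lemma expected_sample_size : (\int[P]_w nn w = \sum_(n <oo) P (running n))%E.
Proof.
under eq_integral do rewrite sample_size_sum.
rewrite integral_nneseries//.
  apply: eq_eseriesr => n _; rewrite integral_indic ?setIT//.
  exact: measurable_running.
by move=> n; exact/measurable_EFinP/measurable_indic/measurable_running.
Qed.

Lemma measurable_coverage calL calU mu :
  measurable_fun [set: R] (calL^~ e) -> measurable_fun [set: R] (calU^~ e) ->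
  measurable (coverage_event L U calL calU delta_ rho (Xs : nat -> T -> R) mu e).
Proof.
move=> mL mU; set cover := coverage_event _ _ _ _ _ _ _ _ _.
have -> : cover = \bigcup_k ([set w | nn w = k%:R%:E] `&`
    ([set w | calL (sample_mean (Xs : nat -> T -> R) k w) e < mu] `&`
     [set w | mu < calU (sample_mean (Xs : nat -> T -> R) k w) e])).
  apply/seteqP; split=> w /=.
    by move=> [k [nk /andP[h1 h2]]]; exists k.
  by move=> [k _ [nk [h1 h2]]]; exists k; split => //; apply/andP.
apply: bigcupT_measurable => k; apply: measurableI.
  rewrite -[X in measurable X]setTI.
  exact: (measurable_sample_size measurableT (emeasurable_set1 _)).
have mltr (f g : T -> R) : measurable_fun [set: T] f -> measurable_fun [set: T] g ->
    measurable [set w | f w < g w].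
  move=> mf mg; rewrite (_ : mkset _ = ~` ([set: T] `&` [set w | g w <= f w])).
    by apply: measurableC; exact: measurable_fun_le.
  by rewrite setTI; apply/seteqP; split=> w /=; rewrite ltNge => /negP.
apply: measurableI; apply: mltr => //.
  by apply: (measurableT_comp mL); exact: measurable_sample_mean.
by apply: (measurableT_comp mU); exact: measurable_sample_mean.
Qed.

End SampleSize.

(** Deterministic core of the coverage estimate: [n] is the size reached, [Sn] and [SN] are the walk
    at [n] and at a fixed time, [yl] and [yu] the lengths of the interval on either side of the
    sample mean. As M kap e = Z s, both [n * yl] and [n * yu] lie between [(Z - a) * q] and
    [(Z + a) * q]; replacing [Sn] by [SN] costs another [a * q]. *)
Lemma coverage_inequalities (R : realType) (a eta Z kap e M s q n Sn SN yl yu : R) :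
  0 < eta <= 2^-1 -> 3 * eta * Z <= a -> 0 < Z -> 0 < kap -> 0 < e -> 0 < M -> 0 < n ->
  0 <= s -> M * (kap * e) = Z * s -> s <= q <= (1 + eta) * s ->
  (1 - eta) * M <= n <= (1 + eta) * M -> `|Sn - SN| < a * q ->
  `|yl - kap * e| <= kap * eta * e -> `|yu - kap * e| <= kap * eta * e ->
  (Sn / n < yl -> - (Sn / n) < yu -> - ((Z + 2 * a) * q) < SN < (Z + 2 * a) * q) /\
  (- ((Z - 2 * a) * q) < SN < (Z - 2 * a) * q -> Sn / n < yl /\ - (Sn / n) < yu).
Proof.
move=> /andP[eta0 eta1] etaZ Z0 k0 e0 M0 n0 s0 MZ /andP[q1 q2] /andP[n1 n2].
rewrite ltr_norml => /andP[d1 d2].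
rewrite ler_norml => /andP[l1 l2]; rewrite ler_norml => /andP[u1 u2].
have ke0 : 0 < kap * e by rewrite mulr_gt0.
have q0 : 0 <= q by apply: le_trans q1.
have Zs0 : 0 <= Z * s by rewrite mulr_ge0// ltW.
have up : n * (kap * e * (1 + eta)) <= (Z + a) * q.
  apply: (@le_trans _ _ ((1 + eta) * M * (kap * e * (1 + eta)))).
    by rewrite ler_wpM2r// mulr_ge0// ?(ltW ke0)//; lra.
  have -> : (1 + eta) * M * (kap * e * (1 + eta)) = (1 + eta) ^+ 2 * Z * s.
    by rewrite -[RHS]mulrA -MZ; ring.
  apply: ler_pM => //; first by rewrite mulr_ge0 ?sqr_ge0// ltW.
  have : (1 + eta) ^+ 2 <= 1 + 3 * eta.
    have : eta * eta <= eta * 1 by rewrite ler_wpM2l//; lra.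
    rewrite (_ : (1 + eta) ^+ 2 = 1 + 2 * eta + eta * eta); [lra|ring].
  by move=> /(ler_wpM2r (ltW Z0)); lra.
have low : (Z - a) * q <= n * (kap * e * (1 - eta)).
  apply: (@le_trans _ _ ((1 - 3 * eta) * Z * q)).
    by rewrite ler_wpM2r//; lra.
  apply: (@le_trans _ _ ((1 - eta) * M * (kap * e * (1 - eta)))); last first.
    by rewrite ler_wpM2r// mulr_ge0// ?(ltW ke0)//; lra.
  have -> : (1 - eta) * M * (kap * e * (1 - eta)) = (1 - eta) ^+ 2 * (Z * s).
    by rewrite -MZ; ring.
  (* As [eta] may reach 1/2, 1 - 3 eta can be negative, and then q cannot be replaced by its upper
     bound. *)
  have [h|/ltW h] := leP (1 - 3 * eta) 0.
    apply: (@le_trans _ _ 0); last by rewrite mulr_ge0// sqr_ge0.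
    by rewrite mulr_le0_ge0// mulr_le0_ge0// ltW.
  apply: (@le_trans _ _ ((1 - 3 * eta) * Z * ((1 + eta) * s))).
    by rewrite ler_wpM2l// mulr_ge0// ltW.
  have -> : (1 - 3 * eta) * Z * ((1 + eta) * s) = ((1 - 3 * eta) * (1 + eta)) * (Z * s) by ring.
  rewrite ler_wpM2r// (_ : (1 - 3 * eta) * (1 + eta) = 1 - 2 * eta - 3 * eta ^+ 2); last by ring.
  rewrite (_ : (1 - eta) ^+ 2 = 1 - 2 * eta + eta ^+ 2); last by ring.
  by have := sqr_ge0 eta; lra.
have nyl : n * yl <= n * (kap * e * (1 + eta)) by rewrite ler_wpM2l ?(ltW n0)//; lra.
have nyu : n * yu <= n * (kap * e * (1 + eta)) by rewrite ler_wpM2l ?(ltW n0)//; lra.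
have nyl' : n * (kap * e * (1 - eta)) <= n * yl by rewrite ler_wpM2l ?(ltW n0)//; lra.
have nyu' : n * (kap * e * (1 - eta)) <= n * yu by rewrite ler_wpM2l ?(ltW n0)//; lra.
rewrite -mulNr !ltr_pdivrMr// ![_ * n]mulrC; split.
  by move=> h1 h2; apply/andP; split; lra.
by move=> /andP[h1 h2]; split; lra.
Qed.

(** Since 1 / i^2 <= 2 / (i (i + 1)), the sum is dominated by a telescoping one. *)
Lemma sum_inv_sqr_le (R : realFieldType) (K : R) m n : 0 <= K -> (0 < m)%N ->
  \sum_(m <= i < n) K / i%:R ^+ 2 <= K * 2 / m%:R.
Proof.
move=> K0 m0; have [mn|/ltnW nm] := leqP m n; last first.
  by rewrite big_geq// divr_ge0// mulr_ge0.
suff : \sum_(m <= i < n) K / i%:R ^+ 2 <= K * 2 / m%:R - K * 2 / n%:R.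
  by move=> h; apply: (le_trans h); rewrite gerBl divr_ge0// mulr_ge0.
elim: n mn => [|n IH]; first by rewrite leqn0 => /eqP m00; rewrite m00 in m0.
rewrite leq_eqVlt => /predU1P[->|]; first by rewrite big_geq// subrr.
rewrite ltnS => mn; rewrite big_nat_recr//=.
have n0 : (0 : R) < n%:R by rewrite ltr0n (leq_trans m0).
apply: (le_trans (lerD (IH mn) (lexx _))).
have n1 : 1 <= n%:R :> R by rewrite ler1n (leq_trans m0).
have n10 : (0 : R) < n%:R + 1 by lra.
have -> : K * 2 / m%:R - K * 2 / n.+1%:R = K * 2 / m%:R - K * 2 / n%:R + K * (2 / (n%:R * (n%:R + 1))).
  have mR : (0 : R) < m%:R by rewrite ltr0n.
  by rewrite -natr1; field; rewrite !gt_eqF.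
rewrite lerD2l ler_wpM2l// -[leLHS]div1r ler_pdivrMr ?exprn_gt0//.
rewrite mulrAC ler_pdivlMr ?mulr_gt0//.
have : 0 <= n%:R * (n%:R - 1) :> R by rewrite mulr_ge0//; lra.
by rewrite mul1r; lra.
Qed.

(** * Sample size ratio, coverage probability and expected sample size *)

Section Procedure.
Context (R : realType) (Theta : set R) (kappa : R -> R) (L U calL calU : R -> R -> R).
Context (delta : R) (delta_ : nat -> R) (rho : R).
Hypothesis kappa_gt0 : forall mu, Theta mu -> 0 < kappa mu.
Hypothesis L_cont : {within [set x : R * R | 0 < x.2],
               continuous (fun x : R * R => L x.1 x.2)}.
Hypothesis U_cont : {within [set x : R * R | 0 < x.2],
               continuous (fun x : R * R => U x.1 x.2)}.
Hypothesis LU_lt : forall eps : R, 0 < eps ->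
  forall mu, Theta mu -> L mu eps < mu < U mu eps.
Hypothesis LU_kappa : margins_equiv Theta kappa L U.
Hypothesis LU_off : margins_vanish_off Theta L U.
Hypothesis calLU_kappa : margins_equiv Theta kappa calL calU.
Hypothesis calL_meas : forall eps : R, 0 < eps -> measurable_fun [set: R] (calL^~ eps).
Hypothesis calU_meas : forall eps : R, 0 < eps -> measurable_fun [set: R] (calU^~ eps).
Hypothesis delta01 : 0 < delta < 1.
Hypothesis delta_01 : forall n, (0 < n)%N -> 0 < delta_ n < 1.
Hypothesis delta_lim : stdnormal_cdf (Num.sqrt (ln (delta_ n)^-1)) @[n --> \oo]
     --> 1 - delta / 2.
Hypothesis rho_gt0 : 0 < rho.
Context (d : measure_display) (T : measurableType d) (P : probability T R).
Context (X : {RV P >-> R}) (Xs : nat -> {RV P >-> R}) (mu nu : R).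
Hypothesis X_iid : iid_samples X Xs.
Hypothesis X_mean : ('E_P[X] = mu%:E)%E.
Hypothesis X_var : ('V_P[X] = nu%:E)%E.
Hypothesis nu_gt0 : 0 < nu.
Hypothesis X_moment : ('E_P[fun w => (`|X w| ^+ 6)%R] < +oo)%E.
Hypothesis Theta_mu : Theta mu.

Let nn := sample_size L U delta_ rho (Xs : nat -> T -> R).
Let cover := coverage_event L U calL calU delta_ rho (Xs : nat -> T -> R) mu.
Let Z : R := stdnormal_quantile (1 - delta / 2).
Let lam n := ln (delta_ n)^-1.
Let M (e : R) := nu * Z ^+ 2 / (kappa mu ^+ 2 * e ^+ 2).
Let Y := sample_mean (Xs : nat -> T -> R).

Let k0 : 0 < kappa mu. Proof. exact: kappa_gt0. Qed.
Let k20 : 0 < kappa mu ^+ 2. Proof. exact: exprn_gt0. Qed.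
Let Z0 : 0 < Z. Proof. exact: quantile_gt0. Qed.
Let Z20 : 0 < Z ^+ 2. Proof. exact: exprn_gt0. Qed.

Let cL e : 0 < e -> continuous (L^~ e). Proof. by move=> e0; exact: slice_continuous L_cont. Qed.
Let cU e : 0 < e -> continuous (U^~ e). Proof. by move=> e0; exact: slice_continuous U_cont. Qed.

Lemma lam_gt0 n : (0 < n)%N -> 0 < lam n.
Proof.
by move=> /delta_01/andP[h0 h1]; rewrite ln_gt0// invf_gt1.
Qed.

Lemma lam_lim : lam n @[n --> \oo] --> Z ^+ 2.
Proof.
apply: cvg_quantile_sqr => //; last exact: lam_gt0.
by case/andP: delta01 => h1 h2; apply/andP; split; lra.
Qed.

Lemma asymp_sizeE e : asymp_size kappa e delta mu nu = M e.
Proof. by rewrite /asymp_size exprMn. Qed.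

Lemma size_ge B : \forall e \near 0^'+, B <= M e.
Proof. exact: near_size_ge. Qed.

Lemma ae_ratio : {ae P, forall w, (nn e w / (M e)%:E)%E @[e --> 0^'+] --> 1%E}.
Proof.
apply: filterS (sample_limits X_iid X_mean X_var X_moment) => w [yw vw].
apply: (first_time_ratio (margin := margin L U) (lam := lam) (mu := mu)
  (y := fun n => sample_mean (Xs : nat -> T -> R) n w)
  (v := fun n => sample_var (Xs : nat -> T -> R) n w)) => //.
- exact: margins_equiv_asymp LU_kappa _ _.
- by move=> z; exact: margin_vanish LU_kappa _ _.
- exact: lam_gt0.
- exact: lam_lim.
- by move=> n; exact: sample_var_ge0.
Qed.

(** The deviation is required at no time from the window onwards, so that off this event it is
    excluded at the random time [nn e] too. *)
Definition atypical eta r e : set T :=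
  [set w | ~ (((1 - eta) * M e)%:E <= nn e w <= ((1 + eta) * M e)%:E)%E] `|`
  [set w | exists2 k, (Num.truncn ((1 - eta) * M e) <= k)%N & r <= `|Y k w - mu|].

Lemma measurable_window eta e : 0 < e ->
  measurable [set w | (((1 - eta) * M e)%:E <= nn e w <= ((1 + eta) * M e)%:E)%E].
Proof.
move=> e0.
have mnn : measurable_fun [set: T] (nn e).
  by apply: measurable_sample_size; [exact: cL|exact: cU].
rewrite (_ : mkset _ = ([set: T] `&` [set w | ((1 - eta) * M e)%:E <= nn e w]%E) `&`
    ([set: T] `&` [set w | nn e w <= ((1 + eta) * M e)%:E]%E)).
  by apply: measurableI; apply: measurable_lee => //; exact: measurable_cst.
by rewrite !setTI; apply/seteqP; split=> w /=; [move=> /andP|move=> ?; apply/andP].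
Qed.

Lemma measurable_deviation r k : measurable [set w | r <= `|Y k w - mu|].
Proof.
rewrite -[X in measurable X]setTI; apply: measurable_fun_le => //.
apply: measurableT_comp => //; apply: measurable_funB => //.
exact: measurable_sample_mean.
Qed.

Lemma measurable_atypical eta r e : 0 < e -> measurable (atypical eta r e).
Proof.
move=> e0; apply: measurableU; first exact/measurableC/measurable_window.
rewrite (_ : mkset _ = \bigcup_(k in [set k | (Num.truncn ((1 - eta) * M e) <= k)%N])
    [set w | r <= `|Y k w - mu|]); last first.
  by apply/seteqP; split=> w [k h1 h2]; exists k.
by apply: bigcup_measurable => k _; exact: measurable_deviation.
Qed.

(** Along almost every path the window holds for small [e], and the start of the window passes the
    last time at which the mean is [r] away from [mu]. *)
Lemma pr_atypical eta r : 0 < eta < 1 -> 0 < r -> pr P (atypical eta r e) @[e --> 0^'+] --> (0 : R).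
Proof.
move=> /andP[eta0 eta1] r0; apply: ae_near_pr0; first by move=> e; exact: measurable_atypical.
apply: filterS (sample_limits X_iid X_mean X_var X_moment) => w [yw vw].
have [N _ NP] : \forall n \near \oo, `|mu - Y n w| < r.
  by move/cvgrPdist_lt : yw => /(_ r r0).
have W : \forall e \near 0^'+,
    (((1 - eta) * M e)%:E <= nn e w <= ((1 + eta) * M e)%:E)%E.
  apply: (first_time_window (margin := margin L U) (lam := lam) (mu := mu)
    (y := fun n => sample_mean (Xs : nat -> T -> R) n w)
    (v := fun n => sample_var (Xs : nat -> T -> R) n w)) => //.
  - exact: margins_equiv_asymp LU_kappa _ _.
  - by move=> z; exact: margin_vanish LU_kappa _ _.
  - exact: lam_gt0.
  - exact: lam_lim.
  - by move=> n; exact: sample_var_ge0.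
near=> e; case.
  by apply; near: e.
have ge : N.+1%:R / (1 - eta) <= M e by near: e; exact: size_ge.
move=> [k /= tk rk].
have Nk : (N <= k)%N.
  apply: leq_trans tk; rewrite truncn_ge_nat; last first.
    by rewrite mulr_ge0//; [lra|apply: le_trans ge; rewrite divr_ge0//; lra].
  move: ge; rewrite ler_pdivrMr; last by lra.
  by rewrite -natr1; lra.
by have := NP k Nk; rewrite /= distrC ltNge rk.
Unshelve. all: by end_near. Qed.

(* Anscombe's argument: off a small event, the walk at the random time nn e is
   within a q of its value at the deterministic time N. *)
Lemma coverage_sandwich (a t : R) : 0 < a -> 0 < t ->
  \forall e \near 0^'+, exists N : nat, let q := Num.sqrt (nu * N%:R) in
    let SN := psum Xs (dev mu) 0 N in
    M e <= N%:R /\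
    pr P (cover e) <= pr P [set w | - ((Z + 2 * a) * q) < SN w < (Z + 2 * a) * q] + t /\
    pr P [set w | - ((Z - 2 * a) * q) < SN w < (Z - 2 * a) * q] <= pr P (cover e) + t.
Proof.
move=> a0 t0.
(* The first two bounds are those of [coverage_inequalities]. The third serves the maximal
   inequality: a block of length 3 eta M and level a q / 2 has probability at most 12 eta / a^2 <= t
   / 2. *)
pose eta := Num.min (2^-1) (Num.min (a / (3 * Z)) (a ^+ 2 * (t / 2) / 12)).
have eta0 : 0 < eta.
  by rewrite !lt_min invr_gt0 ltr0n/= !divr_gt0// !mulr_gt0// ?exprn_gt0// divr_gt0.
have eta1 : eta <= 2^-1 by rewrite ge_min lexx.
have eta2 : 3 * eta * Z <= a.
  have : eta <= a / (3 * Z) by rewrite /eta !ge_min lexx orbT.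
  by rewrite ler_pdivlMr ?mulr_gt0//; lra.
have eta3 : 12 * eta <= a ^+ 2 * (t / 2).
  have : eta <= a ^+ 2 * (t / 2) / 12 by rewrite /eta !ge_min lexx !orbT.
  lra.
have keta0 : 0 < kappa mu * eta by rewrite mulr_gt0.
have [r r0 rP] := margins_equivP calLU_kappa Theta_mu keta0.
have eta01 : 0 < eta < 1 by apply/andP; split => //; lra.
have t20 : 0 < t / 2 by rewrite divr_gt0.
have bad0 := pr_atypical eta01 r0.
near=> e.
have e0 : 0 < e by near: e; exact: nbhs_right_gt.
have er : e < r by near: e; exact: nbhs_right_lt.
have M1 : 1 <= M e by near: e; exact: size_ge.
have Meta : eta^-1 <= M e by near: e; exact: size_ge.
have badt : pr P (atypical eta r e) <= t / 2.
  have : `|0 - pr P (atypical eta r e)| <= t / 2 by near: e; move/cvgrPdist_le : bad0; apply.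
  by rewrite sub0r normrN ger0_norm// pr_ge0.
have M0 : 0 < M e by lra.
have etaM : 1 <= eta * M e by rewrite mulrC -ler_pdivrMr// div1r.
(* The block begins at [m] and contains [N] and the whole window. Its length allows 2 eta M for the
   window and eta M for rounding, as [1 <= eta * M e]. *)
pose N := (Num.truncn (M e)).+1; pose m := Num.truncn ((1 - eta) * M e).
pose len := Num.truncn (3 * eta * M e).
exists N; set q := Num.sqrt (nu * N%:R); set SN := psum Xs (dev mu) 0 N.
have MN : M e <= N%:R by exact/ltW/truncnS_gt.
have NM : N%:R <= M e + 1 by rewrite /N -natr1 lerD2r truncn_le ltW.
have N0 : (0 : R) < N%:R by rewrite ltr0n.
have nuN0 : 0 < nu * N%:R by rewrite mulr_gt0.
have q0 : 0 < q by rewrite sqrtr_gt0.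
have q2 : q ^+ 2 = nu * N%:R by rewrite sqr_sqrtr// ltW.
have e3M : 0 <= 3 * eta * M e.
  by apply: mulr_ge0; [apply: mulr_ge0 => //; exact: ltW|exact: ltW].
have lo0 : 0 <= (1 - eta) * M e by apply: mulr_ge0; [lra|exact: ltW].
have mle : m%:R <= (1 - eta) * M e by rewrite truncn_le.
have mgt : (1 - eta) * M e < m%:R + 1 by rewrite natr1; exact: truncnS_gt.
pose B := max_exceeds Xs (dev mu) (a / 2 * q) m len.
have aq0 : 0 < a / 2 * q by rewrite mulr_gt0// divr_gt0.
have Bt : pr P B <= t / 2.
  apply: (le_trans (dev_maximal X_iid X_mean X_var X_moment m len aq0)).
  rewrite exprMn q2 ler_pdivrMr ?mulr_gt0 ?exprn_gt0 ?divr_gt0//.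
  have lenle : len%:R <= 3 * eta * M e by rewrite truncn_le.
  have h : len%:R <= (t / 2) * (a / 2) ^+ 2 * N%:R.
    apply: (le_trans lenle); apply: ler_pM => //; [by apply: mulr_ge0 => //; exact: ltW|exact: ltW|].
    by rewrite (_ : (a / 2) ^+ 2 = a ^+ 2 / 4); [lra|field].
  rewrite (_ : t / 2 * _ = t / 2 * (a / 2) ^+ 2 * N%:R * nu); last by ring.
  by rewrite ler_wpM2r// ltW.
have in_block (n : nat) : (1 - eta) * M e <= n%:R <= (1 + eta) * M e ->
    (m <= n)%N /\ (n - m <= len)%N.
  move=> /andP[n1 n2]; have mn : (m <= n)%N.
    by rewrite -(ler_nat R); apply: le_trans n1.
  split => //; rewrite truncn_ge_nat//.
  by rewrite natrB//; lra.
pose s := Num.sqrt (nu * M e).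
have nuM0 : 0 < nu * M e by rewrite mulr_gt0.
have s2 : s ^+ 2 = nu * M e by rewrite sqr_sqrtr// ltW.
have s0 : 0 <= s by exact: sqrtr_ge0.
(* At time [M e] the half-width kappa e equals Z standard deviations of the sample mean; this is the
   definition of [M e] under a square root. *)
have MZ : M e * (kappa mu * e) = Z * s.
  have A0 : 0 <= M e * (kappa mu * e).
    by apply: mulr_ge0; [exact: ltW|apply: mulr_ge0; exact: ltW].
  have B0 : 0 <= Z * s by apply: mulr_ge0 => //; exact: ltW.
  apply/eqP; rewrite -(eqrXn2 (ltn0Sn 1) A0 B0); apply/eqP.
  transitivity (M e * (M e * (kappa mu ^+ 2 * e ^+ 2))); first by ring.
  have -> : M e * (kappa mu ^+ 2 * e ^+ 2) = nu * Z ^+ 2.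
    by rewrite /M divfK// gt_eqF// mulr_gt0// exprn_gt0.
  by rewrite [RHS]exprMn s2; ring.
have sq : s <= q <= (1 + eta) * s.
  apply/andP; split; first by apply: ler_wsqrtr; apply: ler_wpM2l => //; exact: ltW.
  have es0 : 0 <= (1 + eta) * s by apply: mulr_ge0 => //; apply: addr_ge0 => //; exact: ltW.
  rewrite -(ler_pXn2r (ltn0Sn 1)) ?nnegrE ?(ltW q0)//.
  rewrite [leRHS]exprMn q2 s2 [leRHS]mulrCA; apply: ler_wpM2l; first exact: ltW.
  apply: (le_trans NM).
  have : 0 <= eta * (eta * M e) by apply: mulr_ge0; [exact: ltW|apply: le_trans etaM].
  by rewrite (_ : (1 + eta) ^+ 2 * M e = M e + 2 * (eta * M e) + eta * (eta * M e)); [lra|ring].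
have core w : ~ atypical eta r e w -> ~ B w -> exists k : nat,
    [/\ nn e w = k%:R%:E, (0 : R) < k%:R,
      Y k w - mu = psum Xs (dev mu) 0 k w / k%:R &
      (psum Xs (dev mu) 0 k w / k%:R < Y k w - calL (Y k w) e ->
       - (psum Xs (dev mu) 0 k w / k%:R) < calU (Y k w) e - Y k w ->
       - ((Z + 2 * a) * q) < SN w < (Z + 2 * a) * q) /\
      (- ((Z - 2 * a) * q) < SN w < (Z - 2 * a) * q ->
       psum Xs (dev mu) 0 k w / k%:R < Y k w - calL (Y k w) e /\
       - (psum Xs (dev mu) 0 k w / k%:R) < calU (Y k w) e - Y k w)].
  move=> /not_orP[/contrapT W nY] nB.
  have [[Woo _]|[k [kgt0 _ Ek _]]] :=
      first_timeP R (fun n => stop_cond L U delta_ rho (Xs : nat -> T -> R) e n w).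
    by move: W; rewrite /nn (_ : sample_size _ _ _ _ _ _ _ = +oo%E)// leye_eq andbF.
  have nnk : nn e w = k%:R%:E by [].
  move: W; rewrite nnk !lee_fin => kM.
  have [mk klen] := in_block k kM.
  have [mN Nlen] : (m <= N)%N /\ (N - m <= len)%N.
    apply: in_block; apply/andP; split.
      by apply: le_trans MN; rewrite ler_piMl ?(ltW M0)// gerBl ltW.
    by apply: (le_trans NM); rewrite mulrDl mul1r lerD2l.
  have small j : (m <= j)%N -> (j - m <= len)%N -> `|psum Xs (dev mu) m j w| < a / 2 * q.
    move=> mj jl; rewrite ltNge; apply/negP => h; apply: nB; exists (j - m)%N => //.
    by rewrite subnKC.
  (* Both times lie in the block, so each value is within a q / 2 of the walk at [m]. *)
  have close : `|psum Xs (dev mu) 0 k w - SN w| < a * q.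
    have := ltrD (small k mk klen) (small N mN Nlen).
    rewrite (psum_cat _ _ _ mk) (psum_cat _ _ _ mN) => h.
    rewrite (_ : a * q = a / 2 * q + a / 2 * q); last by field.
    apply: le_lt_trans h; apply: le_trans (ler_normB _ _).
    by rewrite opprB addrA subrK.
  have kR : (0 : R) < k%:R by rewrite ltr0n.
  have Yr : `|Y k w - mu| < r.
    by rewrite ltNge; apply/negP => h; apply: nY; exists k.
  have [bl bu] := rP (Y k w) e Yr (introT andP (conj e0 er)).
  exists k; split => //.
    by rewrite /Y (sample_mean_psum Xs mu w kgt0) addrAC subrr add0r.
  apply: (coverage_inequalities (eta := eta) (kap := kappa mu) (e := e) (M := M e) (s := s)) => //.
  exact/andP.
have mB : measurable B by exact: measurable_max_exceeds (@measurable_dev _ _) _ _ _.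
have mbad : measurable (atypical eta r e) by exact: measurable_atypical.
have mcover : measurable (cover e).
  apply: measurable_coverage; [exact: cL|exact: cU|exact: calL_meas|exact: calU_meas].
have mSN (c : R) : measurable [set w | - c < SN w < c].
  have mS : measurable_fun [set: T] SN by exact: measurable_psum (@measurable_dev _ _) _ _.
  rewrite (_ : mkset _ = SN @^-1` `]- c, c[%classic).
    by rewrite -[X in measurable X]setTI; apply: mS.
  by apply/seteqP; split=> w; rewrite /= in_itv.
have mBU : measurable (atypical eta r e `|` B) by exact: measurableU.
have prBU : pr P (atypical eta r e `|` B) <= t.
  by apply: (le_trans (prU_le P mbad mB)); rewrite (_ : t = t / 2 + t / 2) ?lerD//; field.
split => //; split.
  apply: (@le_trans _ _ (pr P [set w | - ((Z + 2 * a) * q) < SN w < (Z + 2 * a) * q] +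
      pr P (atypical eta r e `|` B))); last by rewrite lerD2l.
  apply: le_prU; [exact: mcover|exact: mSN|exact: mBU|] => w cw.
  have [?|nb] := pselect ((atypical eta r e `|` B) w); first by right.
  left; move/not_orP : nb => [nbad nB].
  have [k [nnk kR YE [cov _]]] := core w nbad nB.
  move: cw => [k' [nnk']]; have -> : k' = k.
    move: nnk'; rewrite -/(nn e w) nnk => -[] /eqP; rewrite eqr_nat => /eqP ->//.
  rewrite -/Y => /andP[c1 c2].
  by apply: cov; rewrite -YE ?opprB ?ltrD2l ?ltrN2 ?ltrD2r.
apply: (@le_trans _ _ (pr P (cover e) + pr P (atypical eta r e `|` B))); last by rewrite lerD2l.
apply: le_prU; [exact: mSN|exact: mcover|exact: mBU|] => w cw.
have [?|nb] := pselect ((atypical eta r e `|` B) w); first by right.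
left; move/not_orP : nb => [nbad nB].
have [k [nnk kR YE [_ cov]]] := core w nbad nB.
have := cov cw; rewrite -YE opprB ltrD2l ltrN2 ltrD2r => -[c1 c2].
by exists k; split => //; apply/andP.
Unshelve. all: by end_near. Qed.

Lemma measurable_cover e : 0 < e -> measurable (cover e).
Proof.
by move=> e0; apply: measurable_coverage; [exact: cL|exact: cU|exact: calL_meas|exact: calU_meas].
Qed.

Lemma coverage_limit : P (cover e) @[e --> 0^'+] --> (1 - delta)%:E.
Proof.
apply/fine_cvgP; split.
  near=> e; apply: fin_num_measure; apply: measurable_cover.
  by near: e; exact: nbhs_right_gt.
apply/cvgrPdist_le => t t0; rewrite /=.
(* By the Lipschitz constant 17, shifting both ends by 2 a costs 68 a = t / 2; two central limit
   errors and that of the sandwich cost 3 t'. *)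
pose a := t / 136; pose t' := t / 8.
have a0 : 0 < a by rewrite divr_gt0.
have t'0 : 0 < t' by rewrite divr_gt0.
have clt c := dev_central_limit X_iid X_mean X_var nu_gt0 X_moment c t'0.
have [n1 _ P1] := clt (Z + 2 * a); have [n2 _ P2] := clt (- (Z + 2 * a)).
have [n3 _ P3] := clt (Z - 2 * a); have [n4 _ P4] := clt (- (Z - 2 * a)).
have PhiZ : stdnormal_cdf Z = 1 - delta / 2.
  by apply: Phi_quantile; case/andP: delta01 => h1 h2; apply/andP; split; lra.
have sandwich := coverage_sandwich a0 t'0.
near=> e; rewrite -/(pr P (cover e)).
have MB : (maxn (maxn n1 n2) (maxn n3 n4))%:R <= M e by near: e; exact: size_ge.
have [N] : exists N : nat, let q := Num.sqrt (nu * N%:R) in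
    let SN := psum Xs (dev mu) 0 N in
    M e <= N%:R /\
    pr P (cover e) <= pr P [set w | - ((Z + 2 * a) * q) < SN w < (Z + 2 * a) * q] + t' /\
    pr P [set w | - ((Z - 2 * a) * q) < SN w < (Z - 2 * a) * q] <= pr P (cover e) + t'.
  by near: e.
set q := Num.sqrt _; set SN := psum _ _ _ _ => /= -[MN [up low]].
have : (maxn (maxn n1 n2) (maxn n3 n4) <= N)%N by rewrite -(ler_nat R) (le_trans MB).
rewrite !geq_max => /andP[/andP[N1 N2] /andP[N3 N4]].
have q0 : 0 <= q by exact: sqrtr_ge0.
have mS : measurable_fun [set: T] SN by exact: measurable_psum (@measurable_dev _ _) _ _.
have mitv (i : interval R) : measurable (SN @^-1` [set` i]).
  by rewrite -[X in measurable X]setTI; apply: mS.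
have mmid (c : R) : measurable [set w | - c < SN w < c].
  rewrite (_ : mkset _ = SN @^-1` `]- c, c[%classic); first exact: mitv.
  by apply/seteqP; split=> w; rewrite /= in_itv.
have mle (c : R) : measurable [set w | SN w <= c].
  rewrite (_ : mkset _ = SN @^-1` `]-oo, c]%classic); first exact: mitv.
  by apply/seteqP; split=> w; rewrite /= in_itv.
have mlt (c : R) : measurable [set w | SN w < c].
  rewrite (_ : mkset _ = SN @^-1` `]-oo, c[%classic); first exact: mitv.
  by apply/seteqP; split=> w; rewrite /= in_itv.
have cp0 : 0 <= (Z + 2 * a) * q.
  by apply: mulr_ge0 => //; apply: addr_ge0; [exact: (ltW Z0)|apply: mulr_ge0 => //; exact: (ltW a0)].
(* Two-sided probabilities are compared with one-sided ones, open or closed so as to fit the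
   available half of the central limit theorem. *)
have U1 : pr P [set w | - ((Z + 2 * a) * q) < SN w < (Z + 2 * a) * q] +
    pr P [set w | SN w < - (Z + 2 * a) * q] <= pr P [set w | SN w <= (Z + 2 * a) * q].
  apply: prD_le => //.
    apply/disj_set2P; rewrite -subset0 => w /= [/andP[h1 _]].
    by rewrite mulNr => h2; have := lt_trans h1 h2; rewrite ltxx.
  move=> w /= [/andP[_ /ltW//]|]; rewrite mulNr => h; lra.
have U2 : pr P [set w | SN w < (Z - 2 * a) * q] <=
    pr P [set w | - ((Z - 2 * a) * q) < SN w < (Z - 2 * a) * q] +
    pr P [set w | SN w <= - (Z - 2 * a) * q].
  apply: le_prU => // w /= h; have [h'|h'] := leP (SN w) (- (Z - 2 * a) * q); first by right.
  by left; apply/andP; split => //; rewrite -mulNr.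
have := (P1 N N1).1; have := (P2 N N2).2; have := (P3 N N3).2; have := (P4 N N4).1.
rewrite -/q -/SN !PhiN => c4 c3 c2 c1.
have := Phi_lipschitz (Z + 2 * a) Z; have := Phi_lipschitz (Z - 2 * a) Z.
rewrite PhiZ (_ : Z - 2 * a - Z = - (2 * a)); last by ring.
rewrite (_ : Z + 2 * a - Z = 2 * a); last by ring.
have a20 : 0 < 2 * a by rewrite mulr_gt0.
rewrite normrN (gtr0_norm a20) !ler_norml => /andP[l1 l2] /andP[l3 l4].
have ta : t = 136 * a by rewrite /a; field.
have tt : t = 8 * t' by rewrite /t'; field.
by apply/andP; split; lra.
Unshelve. all: by end_near. Qed.

(** Here [b] bounds margin / lam from below near [mu]. If sampling goes on at [n] with the mean near
    [mu], the sample variance plus rho / n exceeds b n >= (1 + eta) nu, so the squared deviations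
    carry an excess proportional to b n. The constant does not depend on [e], [b] or [n]. *)
Lemma running_tail r eta : 0 < r -> 0 < eta -> exists2 C, 0 <= C &
  forall e b n, 0 < e -> 0 < b -> (0 < n)%N -> 2 * rho / (eta * nu) <= n%:R ->
    (1 + eta) * nu <= b * n%:R ->
    (forall z, `|z - mu| < r -> b * lam n <= margin L U z e) ->
  pr P (running L U delta_ rho Xs e n) <= (C + C / b) / n%:R ^+ 2.
Proof.
move=> r0 eta0.
have [C1 C10 H1] := sample_mean_tail X_iid X_mean X_var X_moment r0.
have [C2 C20 H2] := sqdev_tail X_iid X_mean X_var X_moment.
(* The share of b n left after subtracting nu and the eta nu / 2 reserved for rho / n. *)
pose c := eta / (2 * (1 + eta)).
have c0 : 0 < c by rewrite divr_gt0// mulr_gt0//; lra.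
pose C := Num.max C1 (C2 / (c ^+ 2 * nu)).
exists C; first by rewrite le_max C10.
move=> e b n e0 b0 n0 nrho bn mar.
have nR : (0 : R) < n%:R by rewrite ltr0n.
have bn0 : 0 < b * n%:R by rewrite mulr_gt0.
pose a := c * b * n%:R ^+ 2.
have a0 : 0 < a by apply: mulr_gt0; [exact: mulr_gt0|exact: exprn_gt0].
have mrun : measurable (running L U delta_ rho Xs e n).
  by apply: measurable_running; [exact: cL|exact: cU].
have sub : running L U delta_ rho Xs e n `<=`
    [set w | r <= `|Y n w - mu|] `|` [set w | a <= `|psum Xs (sqdev mu nu) 0 n w|].
  move=> w /(running_sub_notstop n0) nstop.
  have [rY|Yr] := leP r `|Y n w - mu|; [by left|right => /=].
  apply: le_trans (ler_norm _); apply/ltW.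
  rewrite ltNge; apply/negP => h; apply: nstop => /=.
  rewrite /stop_cond (sample_var_psum Xs mu nu w n0).
  set y := sample_mean _ n w; set S := psum Xs (sqdev mu nu) 0 n w in h *.
  set D := psum _ _ _ _ _.
  have h1 : b * n%:R <= n%:R / lam n * margin L U y e.
    rewrite mulrAC ler_pdivlMr; last exact: lam_gt0.
    by rewrite mulrAC [leRHS]mulrC ler_wpM2r//; exact: mar.
  apply: le_trans h1.
  have h2 : S / n%:R <= c * b * n%:R.
    by rewrite ler_pdivrMr// (_ : c * b * n%:R * n%:R = a)// /a; ring.
  have h3 : rho / n%:R <= eta * nu / 2.
    rewrite ler_pdivrMr// mulrC -ler_pdivrMr; last by rewrite divr_gt0// mulr_gt0.
    apply: le_trans nrho; rewrite le_eqVlt; apply/orP; left; apply/eqP.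
    by field; rewrite !gt_eqF.
  have h4 : (nu + c * b * n%:R + eta * nu / 2) * (2 * (1 + eta)) <= (b * n%:R) * (2 * (1 + eta)).
    have -> : (nu + c * b * n%:R + eta * nu / 2) * (2 * (1 + eta)) =
        (2 + eta) * ((1 + eta) * nu) + eta * (b * n%:R).
      by rewrite /c; field; lra.
    have := ler_wpM2l (_ : 0 <= 2 + eta) bn => /(_ ltac:(lra)); lra.
  rewrite ler_pM2r in h4; last by rewrite mulr_gt0//; lra.
  by have := sqr_ge0 (D / n%:R); lra.
have mS : measurable [set w | a <= `|psum Xs (sqdev mu nu) 0 n w|].
  exact: measurable_exceeds (@measurable_sqdev _ _ _) _ _ _.
apply: (le_trans (le_prU P mrun (@measurable_deviation r n) mS sub)).
rewrite mulrDl; apply: lerD.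
  by apply: (le_trans (H1 n n0)); rewrite ler_wpM2r ?invr_ge0 ?sqr_ge0// le_max lexx.
apply: (le_trans (H2 a n a0)).
have nub : nu <= b * n%:R.
  by apply: le_trans bn; rewrite ler_peMl ?(ltW nu_gt0)//; lra.
(* Chebyshev gives order 1 / (b^2 n^3); one factor b n is traded for nu, so that only one power of 1
   / b remains. *)
apply: (@le_trans _ _ (C2 / (c ^+ 2 * nu) / b / n%:R ^+ 2)); last first.
  by rewrite ler_wpM2r ?invr_ge0 ?sqr_ge0// ler_wpM2r ?invr_ge0 ?(ltW b0)// le_max lexx orbT.
have -> : n%:R * C2 / a ^+ 2 = C2 / (c ^+ 2 * (b * n%:R)) / b / n%:R ^+ 2.
  by rewrite /a; field; rewrite !gt_eqF.
rewrite ler_wpM2r ?invr_ge0 ?sqr_ge0// ler_wpM2r ?invr_ge0 ?(ltW b0)//.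
have c20 : 0 < c ^+ 2 by rewrite exprn_gt0.
have p1 : 0 < c ^+ 2 * nu by rewrite mulr_gt0.
have p2 : 0 < c ^+ 2 * (b * n%:R) by rewrite mulr_gt0.
by rewrite ler_wpM2l// lef_pV2 ?posrE// ler_wpM2l// ltW.
Qed.

(** The expectation is the sum of the probabilities of still running: the first [m] are bounded by
    1, the others by [running_tail]. As [C] is chosen before [e], [b] and [m], the bound serves both
    a fixed [e] and the limit. *)
Lemma expected_bound r eta : 0 < r -> 0 < eta -> exists2 C, 0 <= C &
  forall e b m, 0 < e -> 0 < b -> (0 < m)%N -> 2 * rho / (eta * nu) <= m%:R ->
    (1 + eta) * nu <= b * m%:R ->
    (forall n z, (m <= n)%N -> `|z - mu| < r -> b * lam n <= margin L U z e) ->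
  (\int[P]_w nn e w <= (m%:R + (C + C / b) * 2 / m%:R)%:E)%E.
Proof.
move=> r0 eta0; have [C C0 HC] := running_tail r0 eta0.
exists C => // e b m e0 b0 m0 mrho bm mar.
have K0 : 0 <= C + C / b by rewrite addr_ge0// divr_ge0// ltW.
have mrun n : measurable (running L U delta_ rho Xs e n).
  by apply: measurable_running; [exact: cL|exact: cU].
rewrite expected_sample_size; [|exact: cL|exact: cU].
rewrite (nneseries_split 0 m)// add0n EFinD; apply: leeD.
  apply: (@le_trans _ _ (\sum_(0 <= k < m) 1)%E).
    by apply: lee_sum => k _; exact: probability_le1.
  by rewrite sumEFin big_const_nat subn0 iter_addr_0.
apply: nneseries_le_bound => // n.
rewrite -(eq_bigr _ (fun j _ => EFin_pr P (mrun j))) sumEFin lee_fin.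
apply: le_trans (sum_inv_sqr_le n K0 m0).
rewrite big_nat_cond [leRHS]big_nat_cond; apply: ler_sum => i /andP[/andP[mi _] _].
apply: HC => //.
- exact: leq_trans mi.
- by apply: (le_trans mrho); rewrite ler_nat.
- by apply: (le_trans bm); rewrite ler_wpM2l ?(ltW b0)// ler_nat.
- by move=> z; exact: mar.
Qed.

Lemma expected_sample_size_finite e : 0 < e -> (\int[P]_w nn e w < +oo)%E.
Proof.
move=> e0; have mar0 := margin_gt0 (LU_lt e0 Theta_mu).
have := margin_continuous (cL e0) (cU e0) (x := mu).
set c0 := margin L U mu e in mar0 => /cvgrPdist_lt/(_ (c0 / 2)).
rewrite divr_gt0// => /(_ isT)/nbhs_ballP[r /= r0 rP].
have [C C0 HC] := expected_bound r0 ltr01.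
have [n1 _ P1] : \forall n \near \oo, `|Z ^+ 2 - lam n| < Z ^+ 2.
  by have := lam_lim => /cvgrPdist_lt/(_ _ Z20).
(* The margin is at least c0 / 2 and [lam n] at most 2 Z^2. *)
pose b := c0 / (4 * Z ^+ 2).
have b0 : 0 < b by apply: divr_gt0 => //; apply: mulr_gt0 => //; exact: Z20.
pose B := Num.max (2 * rho / (1 * nu)) ((1 + 1) * nu / b).
pose m := maxn n1 (Num.truncn B).+1.
have Bm : B <= m%:R.
  by apply: (le_trans (ltW (truncnS_gt B))); rewrite ler_nat leq_maxr.
apply: (@le_lt_trans _ _ _ _ _ (HC e b m e0 b0 _ _ _ _)); last exact: ltry.
- by rewrite /m leq_max orbT.
- by apply: le_trans Bm; rewrite le_max lexx.
- by rewrite [leRHS]mulrC -ler_pdivrMr//; apply: le_trans Bm; rewrite le_max lexx orbT.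
- move=> n z mn zr.
  have nn1 : (n1 <= n)%N by apply: leq_trans mn; rewrite leq_maxl.
  have := P1 n nn1; rewrite /= ltr_norml => /andP[l1 _].
  have := rP z; rewrite /ball /= distrC => /(_ zr); rewrite ltr_norml => /andP[_ m1].
  have : b * lam n <= b * (2 * Z ^+ 2) by rewrite ler_wpM2l ?(ltW b0)//; lra.
  have -> : b * (2 * Z ^+ 2) = c0 / 2 by rewrite /b; field; rewrite gt_eqF// Z0.
  rewrite /c0 in m1 *; lra.
Qed.

Lemma sample_size_finite e : 0 < e -> P [set w | (nn e w < +oo)%E] = 1%E.
Proof.
move=> e0; have mnn : measurable_fun [set: T] (nn e).
  by apply: measurable_sample_size; [exact: cL|exact: cU].
have inn : P.-integrable [set: T] (nn e).
  apply/integrableP; split => //; under eq_integral do rewrite gee0_abs ?sample_size_ge0//.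
  exact: expected_sample_size_finite.
have mA : measurable [set w | (nn e w < +oo)%E].
  rewrite -[X in measurable X]setTI; exact: emeasurable_fun_infty_o.
have := integrable_ae measurableT inn => -[A [mA' PA sub]].
rewrite -(@probability_setT _ _ _ P); apply/eqP; rewrite eq_le; apply/andP; split.
  by apply: le_measure; rewrite ?inE.
rewrite -[leRHS]adde0 -PA; apply: (@le_trans _ _ (P ([set w | (nn e w < +oo)%E] `|` A))).
  apply: le_measure; rewrite ?inE//; first exact: measurableU.
  move=> w _; have [h|h] := pselect (nn e w < +oo)%E; [by left|right].
  by apply: sub => /= /(_ I); rewrite fin_numElt => /andP[_ h']; apply: h.
by apply: measureU2.
Qed.

(** From below, [nn e] is at least (1 - eta) M on an event of probability at least 1 - eta. From
    above, [expected_bound] is applied with [m] close to M; as 1 / b is of order M, its error term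
    stays bounded. *)
Lemma expected_sample_size_ratio :
  ((\int[P]_w nn e w) / (M e)%:E)%E @[e --> 0^'+] --> 1%E.
Proof.
have I0 e : (0 <= \int[P]_w nn e w)%E.
  by apply: integral_ge0 => w _; exact: sample_size_ge0.
have Ifin e : 0 < e -> (\int[P]_w nn e w)%E \is a fin_num.
  by move=> e0; rewrite ge0_fin_numE//; exact: expected_sample_size_finite.
have ratioE e : 0 < e -> 1 <= M e ->
    ((\int[P]_w nn e w) / (M e)%:E)%E = (fine (\int[P]_w nn e w) / M e)%:E.
  move=> e0 M1; rewrite -{1}(fineK (Ifin e e0)) inver gt_eqF//; lra.
apply/fine_cvgP; split.
  near=> e.
  have e0 : 0 < e by near: e; exact: nbhs_right_gt.
  have M1 : 1 <= M e by near: e; exact: size_ge.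
  by rewrite ratioE.
apply/cvgrPdist_le => t t0.
pose eta := Num.min (t / 8) (5^-1).
have eta0 : 0 < eta by rewrite lt_min !divr_gt0//= invr_gt0 ltr0n.
have eta5 : eta <= 5^-1 by rewrite ge_min lexx orbT.
have etat : eta <= t / 8 by rewrite ge_min lexx.
have eta01 : 0 < eta < 1 by apply/andP; split => //; lra.
have ome : 0 < 1 - eta by lra.
have ope : 0 < 1 + eta by lra.
have [r r0 rP] := margins_equiv_asymp LU_kappa Theta_mu k0 eta0.
have [C C0 HC] := expected_bound r0 eta0.
have bad0 := pr_atypical eta01 r0.
have etaZ0 : 0 < eta * Z ^+ 2 by apply: mulr_gt0 => //; exact: Z20.
have [n1 _ P1] : \forall n \near \oo, `|Z ^+ 2 - lam n| < eta * Z ^+ 2.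
  by have := lam_lim => /cvgrPdist_lt/(_ _ etaZ0).
pose C' := C + 2 * C / nu.
have C'0 : 0 <= C' by rewrite addr_ge0// divr_ge0 ?mulr_ge0 ?(ltW nu_gt0).
near=> e; have e0 : 0 < e by near: e; exact: nbhs_right_gt.
have er : e < r by near: e; exact: nbhs_right_lt.
have M1 : 1 <= M e by near: e; exact: size_ge.
have Mn1 : n1%:R <= M e by near: e; exact: size_ge.
have Mrho : 2 * rho / (eta * nu) <= M e by near: e; exact: size_ge.
have MC : (1 + 2 * C') * 2 / t <= M e by near: e; exact: size_ge.
have badt : pr P (atypical eta r e) <= eta.
  have : `|0 - pr P (atypical eta r e)| <= eta by near: e; move/cvgrPdist_le : bad0; apply.
  by rewrite sub0r normrN ger0_norm// pr_ge0.
have M0 : 0 < M e by exact: lt_le_trans M1.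
rewrite /= ratioE//=.
set I := fine _.
have lowI : (1 - eta) * M e * (1 - eta) <= I.
  rewrite -lee_fin fineK ?Ifin//.
  have mW := @measurable_window eta e e0.
  pose W := [set w | (((1 - eta) * M e)%:E <= nn e w <= ((1 + eta) * M e)%:E)%E].
  have lo0 : 0 <= (1 - eta) * M e by apply: mulr_ge0; exact: ltW.
  have prW : 1 - eta <= pr P W.
    have mbad : measurable (atypical eta r e) by exact: measurable_atypical.
    have : pr P (~` W) <= pr P (atypical eta r e).
      by apply: le_pr => //; [exact: measurableC|move=> w; left].
    by rewrite prC//; lra.
  apply: (@le_trans _ _ (\int[P]_w (((1 - eta) * M e) * \1_W w)%:E)%E).
    have := EFin_mean (L1Z ((1 - eta) * M e) (L1_indic P mW)) => ->.
    rewrite meanZ ?mean_indic//; last exact: L1_indic.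
    by rewrite lee_fin ler_wpM2l.
  apply: ge0_le_integral => //.
  - by move=> w _; rewrite lee_fin mulr_ge0.
  - exact/measurable_EFinP/(L1_measurable (L1Z _ (L1_indic P mW))).
  - by apply: measurable_sample_size; [exact: cL|exact: cU].
  - move=> w _; rewrite indicE; case: (boolP (w \in W)) => [|_].
      by rewrite inE mulr1 => /andP[].
    by rewrite mulr0; exact: sample_size_ge0.
(* Least margin near [mu] over largest [lam n] beyond [n1]. *)
pose b := kappa mu ^+ 2 * (1 - eta) * e ^+ 2 / (Z ^+ 2 * (1 + eta)).
have e20 : 0 < e ^+ 2 by rewrite exprn_gt0.
have b0 : 0 < b.
  apply: divr_gt0; first by apply: mulr_gt0 => //; apply: mulr_gt0.
  exact: mulr_gt0.
have bM : b * M e = nu * (1 - eta) / (1 + eta).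
  by have z0 := Z0; have kk0 := k0; rewrite /b /M; field; rewrite !gt_eqF.
(* The requirement (1 + eta) nu <= b m follows from (1 + 4 eta)(1 - eta) >= (1 + eta)^2, which holds
   for 0 <= eta <= 1/5: hence the 1/5 in [eta]. *)
pose m := (Num.truncn ((1 + 4 * eta) * M e)).+1.
have mgt : (1 + 4 * eta) * M e < m%:R by exact: truncnS_gt.
have mle : m%:R <= (1 + 4 * eta) * M e + 1.
  by rewrite /m -natr1 lerD2r truncn_le; apply: mulr_ge0; [apply: addr_ge0 => //; apply: mulr_ge0 => //|]; exact: ltW.
have Mm : M e <= m%:R.
  apply: le_trans (ltW mgt); rewrite ler_peMl ?(ltW M0)// lerDl.
  by apply: mulr_ge0 => //; exact: ltW.
have upI : I <= m%:R + (C + C / b) * 2 / m%:R.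
  rewrite -lee_fin fineK ?Ifin//; apply: HC => //.
  - by apply: le_trans Mm.
  - apply: (@le_trans _ _ (b * ((1 + 4 * eta) * M e))); last first.
      by apply: ler_wpM2l; exact: ltW.
    rewrite mulrCA bM mulrA ler_pdivlMr//.
    have : 0 <= nu * (eta * (5^-1 - eta)).
      by apply: mulr_ge0; [exact: ltW|apply: mulr_ge0; [exact: ltW|rewrite subr_ge0]].
    lra.
  - move=> n z mn zr.
    have nn1 : (n1 <= n)%N.
      by apply: leq_trans mn; rewrite -(ler_nat R); apply: le_trans Mm.
    have := P1 n nn1; rewrite /= ltr_norml => /andP[l1 _].
    have /andP[m1 _] := rP z e zr (introT andP (conj e0 er)).
    apply: le_trans m1; rewrite /b mulrAC ler_pdivrMr; last by apply: mulr_gt0 => //; exact: Z20.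
    apply: ler_wpM2l; last by lra.
    by apply: mulr_ge0; [apply: mulr_ge0|]; apply: ltW => //; exact: k20.
have m0 : (0 : R) < m%:R by rewrite ltr0n.
have err : (C + C / b) * 2 / m%:R <= 2 * C'.
  have bV : b^-1 <= 2 * M e / nu.
    rewrite -[leLHS]div1r ler_pdivrMr// mulrAC ler_pdivlMr// -mulrA [M e * b]mulrC bM.
    rewrite mulrA ler_pdivlMr//.
    have : 0 <= nu * (3^-1 - eta) by apply: mulr_ge0; [exact: ltW|lra].
    lra.
  rewrite ler_pdivrMr//; apply: (@le_trans _ _ (2 * C' * M e)); last first.
    by rewrite ler_wpM2l// mulr_ge0.
  have : C * b^-1 <= C * (2 * M e / nu) by rewrite ler_wpM2l.
  have : C * 1 <= C * M e by rewrite ler_wpM2l.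
  rewrite /C' (_ : 2 * (C + 2 * C / nu) * M e = 2 * (C * M e) + 2 * (C * (2 * M e / nu))); last by ring.
  lra.
have MC' : 1 + 2 * C' <= t / 2 * M e.
  by move: MC; rewrite ler_pdivrMr//; lra.
rewrite ler_norml; apply/andP; split.
  rewrite lerBrDr addrC -lerBrDr opprK ler_pdivrMr//.
  have : 4 * eta * M e <= t / 2 * M e by rewrite ler_wpM2r ?(ltW M0)//; lra.
  lra.
rewrite lerBlDr addrC -lerBlDr ler_pdivlMr//.
have : (1 - t) * M e <= (1 - 2 * eta) * M e by rewrite ler_wpM2r ?(ltW M0)//; lra.
have : 0 <= eta ^+ 2 * M e by rewrite mulr_ge0 ?sqr_ge0// ltW.
rewrite (_ : (1 - eta) * M e * (1 - eta) = (1 - 2 * eta) * M e + eta ^+ 2 * M e) in lowI; last by ring.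
lra.
Unshelve. all: by end_near. Qed.

Lemma sampling_properties :
  [/\ forall e : R, 0 < e ->
        P [set w | (nn e w < +oo)%E] = 1%E /\ (\int[P]_w nn e w < +oo)%E,
      {ae P, forall w, (nn e w / (asymp_size kappa e delta mu nu)%:E)%E
         @[e --> 0^'+] --> 1%E},
      P (cover e) @[e --> 0^'+] --> (1 - delta)%:E &
      ((\int[P]_w nn e w) / (asymp_size kappa e delta mu nu)%:E)%E
        @[e --> 0^'+] --> 1%E].
Proof.
have sizeE (f : R -> \bar R) :
    (fun e => (f e / (asymp_size kappa e delta mu nu)%:E)%E) =
    (fun e => (f e / (M e)%:E)%E).
  by apply/funext => e; rewrite asymp_sizeE.
split.
- by move=> e e0; split; [exact: sample_size_finite|exact: expected_sample_size_finite].
- by apply: filterS ae_ratio => w; rewrite (sizeE (nn^~ w)).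
- exact: coverage_limit.
- by rewrite (sizeE (fun e => \int[P]_w nn e w)%E); exact: expected_sample_size_ratio.
Qed.

End Procedure.

Theorem theorem4 (R : realType) (Theta : set R) (kappa : R -> R)
  (L U calL calU : R -> R -> R)
  (delta : R) (delta_ : nat -> R) (rho : R)
  (Theta_itv : is_interval Theta)
  (kappa_gt0 : forall mu, Theta mu -> 0 < kappa mu)
  (kappa_cont : {within Theta, continuous kappa})
  (L_cont : {within [set x : R * R | 0 < x.2],
               continuous (fun x : R * R => L x.1 x.2)})
  (U_cont : {within [set x : R * R | 0 < x.2],
               continuous (fun x : R * R => U x.1 x.2)})
  (LU_le : forall eps : R, 0 < eps -> forall z, L z eps <= z <= U z eps)
  (LU_lt : forall eps : R, 0 < eps ->
     forall mu, Theta mu -> L mu eps < mu < U mu eps)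
  (LU_kappa : margins_equiv Theta kappa L U)
  (LU_off : margins_vanish_off Theta L U)
  (calLU_kappa : margins_equiv Theta kappa calL calU)
  (calL_meas : forall eps : R, 0 < eps -> measurable_fun [set: R] (calL^~ eps))
  (calU_meas : forall eps : R, 0 < eps -> measurable_fun [set: R] (calU^~ eps))
  (delta01 : 0 < delta < 1)
  (delta_01 : forall n, (0 < n)%N -> 0 < delta_ n < 1)
  (delta_lim : stdnormal_cdf (Num.sqrt (ln (delta_ n)^-1)) @[n --> \oo]
     --> 1 - delta / 2)
  (rho01 : 0 < rho <= 1)
  (d : measure_display) (T : measurableType d) (P : probability T R)
  (X : {RV P >-> R}) (Xs : nat -> {RV P >-> R}) (mu nu : R)
  (X_iid : iid_samples X Xs)
  (X_mean : ('E_P[X] = mu%:E)%E)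
  (X_var : ('V_P[X] = nu%:E)%E)
  (nu_gt0 : 0 < nu)
  (X_moment6 : ('E_P[fun w => (`|X w| ^+ 6)%R] < +oo)%E)
  (Theta_mu : Theta mu) :
  let nn := sample_size L U delta_ rho Xs in
  let NN := fun eps => asymp_size kappa eps delta mu nu in
  let cover := coverage_event L U calL calU delta_ rho Xs mu in
  [/\ forall eps : R, 0 < eps ->
        P [set w | (nn eps w < +oo)%E] = 1%E /\
        (\int[P]_w nn eps w < +oo)%E,
      {ae P, forall w, (nn eps w / (NN eps)%:E)%E @[eps --> 0^'+] --> 1%E},
      P (cover eps) @[eps --> 0^'+] --> (1 - delta)%:E &
      ((\int[P]_w nn eps w) / (NN eps)%:E)%E @[eps --> 0^'+] --> 1%E].
Proof.
have rho_gt0 : 0 < rho by case/andP: rho01.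
exact: (sampling_properties kappa_gt0 L_cont U_cont LU_lt LU_kappa LU_off calLU_kappa
  calL_meas calU_meas delta01 delta_01 delta_lim rho_gt0 X_iid X_mean X_var nu_gt0
  X_moment6 Theta_mu).
Qed.
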